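(* Let $F(z)=zM+D+B^T(zI_n-A)^{-1}B\in\mathcal{PRO}_m$ with $\det F(z)\not\equiv0$, where $n\ge 0$ is an integer, $M,D\in\mathbb{R}^{m\times m}$, $B\in\mathbb{R}^{n\times m}$, $A\in\mathbb{R}^{n\times n}$, $M\ge 0$, $A^T=-A$, $D^T=-D$ and $(A,B)$ is controllable. Let $m_1,m_2,m_3$ and $A_{\rm inv}$ (the state matrix of a minimal realization of $F^{-1}$) be as defined in the context. Then for any integer $j\ge 0$ $$\lambda_{j-\frac{m_2}{2}-m_3}(iA_{\rm inv})\leq \lambda_j(iA) \leq \lambda_{j+1}(iA)\leq \lambda_{j+\frac{m_2}{2}+m_1+1}(iA_{\rm inv}),$$ $$\lambda_{j-\frac{m_2}{2}-m_1}(iA)\leq \lambda_j(iA_{\rm inv}) \leq \lambda_{j+1}(iA_{\rm inv})\leq \lambda_{j+\frac{m_2}{2}+m_3+1}(iA).$$ In particular, if $0\le\omega_j<\omega_{j+1}$ are such that $i\omega_j$ and $i\omega_{j+1}$ are subsequent poles of $F$, then the multiplicities of the zeros of $F$ in the open interval $(i\omega_j,i\omega_{j+1})$ on $i\mathbb{R}$ add up to at most $m$. Moreover, if $0\le\nu_j<\nu_{j+1}$ are such that $i\nu_j$ and $i\nu_{j+1}$ are subsequent zeros of $F$, then the multiplicities of the poles of $F$ in the open interval $(i\nu_j,i\nu_{j+1})$ on $i\mathbb{R}$ add up to at most $m$.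
   Context: For a square matrix $K$, $\mathrm{Re}(K)=\frac12(K+K^* )$ and $K\ge 0$ means positive semidefinite. $\mathcal{PRO}_m$ is the class of $m\times m$ rational matrix functions $F$ with $\mathrm{Re}(F(z))\ge 0$ for $\mathrm{Re}(z)>0$, $F(t)\in\mathbb{R}^{m\times m}$ for $t\in\mathbb{R}$ not a pole, and $-F(z)=F(-\overline z)^*$ for $z$ not a pole of $F$. (Every $F$ of the stated form lies in $\mathcal{PRO}_m$ and every element of $\mathcal{PRO}_m$ has this form.) $(A,B)$ is controllable if $[B\ AB\ \cdots\ A^{n-1}B]$ has rank $n$. Eigenvalue notation: for a Hermitian $H\in\mathbb{C}^{k\times k}$, $\lambda_1(H)\le\dots\le\lambda_k(H)$ are its eigenvalues in increasing order, counted with multiplicity, and $\lambda_j(H)=-\infty$ for $j<1$, $\lambda_j(H)=\infty$ for $j>k$. Poles and zeros: the multiplicity of a finite pole of a function in $\mathcal{PRO}_m$ is the dimension of the corresponding eigenspace of the state matrix $A$ in a realization $zM+D+B^T(zI-A)^{-1}B$ with $M\ge0$, $A^T=-A$, $D^T=-D$, $(A,B)$ controllable; the finite poles are exactly the eigenvalues of $A$, which lie on $i\mathbb{R}$. The zeros of $F$ (when $\det F\not\equiv0$) are the poles of $F^{-1}\in\mathcal{PRO}_m$, with the same multiplicities; so the finite zeros are the eigenvalues of $A_{\rm inv}$ below, with multiplicity the dimension of the eigenspace. Decomposition: $\mathbb{R}^m=\mathcal{X}_1\oplus\mathcal{X}_2\oplus\mathcal{X}_3$ (orthogonal), with $\mathcal{X}_1=(\ker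 M)^\perp$, $\mathcal{X}_3=\ker(P_{\ker M}D|_{\ker M})\subset\ker M$, and $\mathcal{X}_2$ the orthogonal complement of $\mathcal{X}_3$ in $\ker M$; here $P_{\ker M}$ is the orthogonal projection onto $\ker M$. With respect to this decomposition $$B=\begin{bmatrix}B_1&B_2&B_3\end{bmatrix},\quad D=\begin{bmatrix}D_{11}&D_{12}&D_{13}\\ -D_{12}^T&D_{22}&0\\ -D_{13}^T&0&0\end{bmatrix},\quad M=\begin{bmatrix}M_1&0&0\\ 0&0&0\\ 0&0&0\end{bmatrix},$$ with $M_1$ positive definite and $D_{22}$ invertible and skew-symmetric. Put $m_i=\dim\mathcal{X}_i$ ($m_2$ is even). Let $K_1:\mathcal{X}_1\to\mathbb{R}^{m_1}$ and $\Xi:\mathcal{X}_3\to\mathbb{R}^{m_3}$ be linear maps with $K_1^TK_1=M_1$ and $\Xi^T\Xi=I_{\mathcal{X}_3}$ (so $K_1$ is invertible and $\Xi$ orthogonal); $K_1^{-T}=(K_1^{-1})^T$. Define $$\widetilde{A}=\begin{bmatrix}A-B_2D_{22}^{-1}B_2^T&(B_1+B_2D_{22}^{-1}D_{12}^T)K_1^{-1}\\ K_1^{-T}(-B_1^T+D_{12}D_{22}^{-1}B_2^T)&-K_1^{-T}(D_{11}+D_{12}D_{22}^{-1}D_{12}^T)K_1^{-1}\end{bmatrix},\quad \widetilde{B}=\begin{bmatrix}B_3\Xi^T\\ -K_1^{-T}D_{13}\Xi^T\end{bmatrix}.$$ The condition $\det F(z)\not\equiv0$ is equivalent to $\ker\widetilde{B}=\{0\}$.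 Let $\Gamma\in\mathbb{R}^{(n+m_1)\times k}$, $k=n+m_1-m_3$, be an isometry with $\mathrm{Im}\,\Gamma\perp\mathrm{Im}\,\widetilde{B}$. Then $A_{\rm inv}=\Gamma^T\widetilde{A}\,\Gamma\in\mathbb{R}^{k\times k}$, which is the state matrix of a realization $F(z)^{-1}=zM_{\rm inv}+D_{\rm inv}+B_{\rm inv}^T(zI_k-A_{\rm inv})^{-1}B_{\rm inv}$ with $M_{\rm inv}\ge0$, $D_{\rm inv}$ and $A_{\rm inv}$ real skew-symmetric and $(A_{\rm inv},B_{\rm inv})$ controllable; explicitly, with $$\Phi_{33}=B_3^TB_3+D_{13}^TM_1^{-1}D_{13},\qquad \Phi_{23}=B_2^TB_3+D_{12}^TM_1^{-1}D_{13},$$ $$B_{\rm inv}=\Gamma^T\begin{bmatrix} 0 & B_2D_{22}^{-1} & (AB_3-B_1M_1^{-1}D_{13}-B_2D_{22}^{-1}\Phi_{23})\Phi_{33}^{-1}\\ K_1^{-T} & -K_1^{-T}D_{12}D_{22}^{-1} & -K_1^{-T}(B_1^TB_3-D_{11}M_1^{-1}D_{13}-D_{12}D_{22}^{-1}\Phi_{23})\Phi_{33}^{-1}\end{bmatrix}.$$ *)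

(* Defs.v *)
From HB Require Import structures.
From mathcomp Require Import all_boot all_order all_algebra.
From mathcomp Require Import complex reals constructive_ereal.

Set Implicit Arguments.
Unset Strict Implicit.
Unset Printing Implicit Defensive.

Import Order.TTheory GRing.Theory Num.Theory.
Local Open Scope ring_scope.

Section MatrixFunctions.
Variable R : realType.
Local Notation C := R[i].

Definition ratfun := {fraction {poly C}}.

Definition const_rf (c : C) : ratfun := FracField.tofrac c%:P.
Definition var_rf : ratfun := FracField.tofrac 'X.

Definition cmx p q (A : 'M[R]_(p, q)) : 'M[C]_(p, q) :=
  map_mx (fun x : R => x%:C%C) A.

Definition ratmx p q (A : 'M[R]_(p, q)) : 'M[ratfun]_(p, q) :=
  map_mx const_rf (cmx A).

Definition ctrmx p q (K : 'M[C]_(p, q)) : 'M[C]_(q, p) :=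
  map_mx Num.conj K^T.

Definition remx m (K : 'M[C]_m) : 'M[C]_m := 2^-1 *: (K + ctrmx K).

(* In the order of [C], [0 <= c] means that [c] is real and nonnegative. *)
Definition psdmx m (K : 'M[C]_m) : Prop :=
  ctrmx K = K /\ forall x : 'cV[C]_m, 0 <= (ctrmx x *m K *m x) 0 0.

(* [rf_value f z v]: [z] is not a pole of [f] and [f(z) = v]. *)
Definition rf_value (f : ratfun) (z v : C) : Prop :=
  exists p q : {poly C},
    [/\ q.[z] != 0, f = FracField.tofrac p / FracField.tofrac q
      & v = p.[z] / q.[z]].

Definition mx_value m (F : 'M[ratfun]_m) (z : C) (V : 'M[C]_m) : Prop :=
  forall i j, rf_value (F i j) z (V i j).

Definition PRO m (F : 'M[ratfun]_m) : Prop :=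
  [/\ forall z : C, 0 < complex.Re z ->
        exists2 V, mx_value F z V & psdmx (remx V),
      forall (t : R) V, mx_value F t%:C%C V ->
        forall i j, V i j \is Num.real
    & forall z V, mx_value F z V -> mx_value F (- Num.conj z) (- ctrmx V)].

Definition controllable n m (A : 'M[R]_n) (B : 'M[R]_(n, m)) : Prop :=
  \rank (\mxrow_(j < n) (A ^+ j *m B)) = n.

Definition realization n m (F : 'M[ratfun]_m) (M D : 'M[R]_m)
    (B : 'M[R]_(n, m)) (A : 'M[R]_n) : Prop :=
  [/\ psdmx (cmx M), A^T = - A, D^T = - D, controllable A B
    & F = var_rf *: ratmx M + ratmx D
          + (ratmx B)^T *m invmx (var_rf%:M - ratmx A) *m ratmx B].

(* [pole_mult F z k]: the multiplicity of [z] as a finite pole of [F] is [k];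
   [k = 0] when [z] is not a pole. *)
Definition pole_mult m (F : 'M[ratfun]_m) (z : C) (k : nat) : Prop :=
  exists n (M D : 'M[R]_m) (B : 'M[R]_(n, m)) (A : 'M[R]_n),
    realization F M D B A /\ \rank (eigenspace (cmx A) z) = k.

Definition zero_mult m (F : 'M[ratfun]_m) (z : C) (k : nat) : Prop :=
  pole_mult (invmx F) z k.

Definition pole m (F : 'M[ratfun]_m) (z : C) : Prop :=
  exists2 k, (0 < k)%N & pole_mult F z k.

Definition zero m (F : 'M[ratfun]_m) (z : C) : Prop :=
  exists2 k, (0 < k)%N & zero_mult F z k.

Definition iR (w : R) : C := 'i%C * w%:C%C.

(* [P] holds at [i a] and [i b], and nowhere strictly between them. *)
Definition subsequent (P : C -> Prop) (a b : R) : Prop :=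
  [/\ a < b, P (iR a), P (iR b) & forall w, a < w < b -> ~ P (iR w)].

(* The multiplicities [mult] on the open segment from [i a] to [i b] add up to
   at most [N]: every finite partial sum does. *)
Definition mult_sum_le (mult : C -> nat -> Prop) (a b : R) (N : nat) : Prop :=
  forall (s : seq R) (mu : R -> nat), uniq s ->
    (forall w, w \in s -> a < w < b /\ mult (iR w) (mu w)) ->
    (\sum_(w <- s) mu w <= N)%N.

(* The eigenvalues of a Hermitian matrix in increasing order: the roots of the
   characteristic polynomial with multiplicity, all of which are real. *)
Definition eigvals k (H : 'M[C]_k) : seq R :=
  sort <=%R [seq complex.Re x
            | x <- sval (closed_field_poly_normal (char_poly H))].

Definition lambda k (H : 'M[C]_k) (j : int) : \bar R :=
  if j < 1 then -oo%E
  else if k%:Z < j then +oo%E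
  else ((eigvals H)`_(`|j|%N.-1))%:E%E.

Definition imx k (A : 'M[R]_k) : 'M[C]_k := 'i%C *: cmx A.

(* A subspace of R^m is the row space of a matrix, whose rows are the
   transposes of column vectors. *)
Definition orthc p m (U : 'M[R]_(p, m)) : 'M[R]_m := kermx U^T.

(* {x | M x = 0} *)
Definition kerM m (M : 'M[R]_m) : 'M[R]_m := kermx M^T.

Definition X1 m (M : 'M[R]_m) : 'M[R]_m := orthc (kerM M).

(* [proj_mx (kerM M) (orthc (kerM M))] acts on the right of row vectors as the
   orthogonal projection onto ker M. *)
Definition X3 m (M D : 'M[R]_m) : 'M[R]_m :=
  (kerM M :&: kermx (D^T *m proj_mx (kerM M) (orthc (kerM M))))%MS.

Definition X2 m (M D : 'M[R]_m) : 'M[R]_m := (kerM M :&: orthc (X3 M D))%MS.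

(* The columns of [V] form an orthonormal basis of [U]; hence p = dim U. *)
Definition orthonormal_basis m p (U : 'M[R]_m) (V : 'M[R]_(m, p)) : Prop :=
  V^T *m V = 1%:M /\ (V^T == U)%MS.

Section Inverse.
(* [Vi] is an orthonormal basis of X_i; operators from, to and between the X_i
   are represented in these bases. *)
Variables (n m m1 m2 m3 : nat).
Variables (M D : 'M[R]_m) (B : 'M[R]_(n, m)) (A : 'M[R]_n).
Variables (V1 : 'M[R]_(m, m1)) (V2 : 'M[R]_(m, m2)) (V3 : 'M[R]_(m, m3)).
Variables (K1 : 'M[R]_m1) (Xi : 'M[R]_m3).

Let B1 := B *m V1.
Let B2 := B *m V2.
Let B3 := B *m V3.
Let D11 := V1^T *m D *m V1.
Let D12 := V1^T *m D *m V2.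
Let D13 := V1^T *m D *m V3.
Let D22 := V2^T *m D *m V2.
Let K1i := invmx K1.
Let D22i := invmx D22.

Definition Atilde : 'M[R]_(n + m1) :=
  block_mx
    (A - B2 *m D22i *m B2^T)
    ((B1 + B2 *m D22i *m D12^T) *m K1i)
    (K1i^T *m (- B1^T + D12 *m D22i *m B2^T))
    (- (K1i^T *m (D11 + D12 *m D22i *m D12^T) *m K1i)).

Definition Btilde : 'M[R]_(n + m1, m3) :=
  col_mx (B3 *m Xi^T) (- (K1i^T *m D13 *m Xi^T)).

Definition Ainv k (Gamma : 'M[R]_(n + m1, k)) : 'M[R]_k :=
  Gamma^T *m Atilde *m Gamma.

End Inverse.

End MatrixFunctions.

(* Main.v *)
Require Import Defs.
From HB Require Import structures.
From mathcomp Require Import all_boot all_order all_algebra.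
From mathcomp Require Import boolp complex reals constructive_ereal.
From mathcomp Require Import spectral sesquilinear.
From mathcomp Require Import ring lra zify.

Set Implicit Arguments.
Unset Strict Implicit.
Unset Printing Implicit Defensive.

Import Order.TTheory GRing.Theory Num.Theory.
Local Open Scope ring_scope.

(** A real skew-symmetric matrix [A] gives the Hermitian matrix [imx A], that is
    iA, and everything rests on one way of comparing two such spectra.  Say that
    [A] and [A'] have a common compression of dimension r when a space of
    dimension r embeds in both state spaces with the same Gram matrix and the
    same form: P P^T = Q Q^T and P A P^T = Q A' Q^T with P, Q row free.  A nonzero
    vector of that space cannot lie both in the spectral subspace of iA' for
    eigenvalues at most t and in the one of iA for eigenvalues above t, so r is
    at most the number of eigenvalues of iA' above t plus the number of
    eigenvalues of iA at most t ([spectral_comparison]).  Hence the eigenvalues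
    interlace with shifts n - r and n' - r ([lambda_le]), and a gap in the
    spectrum of iA contains at most n + n' - 2r eigenvalues of iA'
    ([gap_count]).

    The two chains of inequalities.  Both [A], corrected by B2 D22^-1 B2^T, and
    [Ainv] are compressions of the matrix [Atilde], the first by dropping the last
    m1 coordinates, the second by the isometry [Gamma].  A real skew-symmetric
    form of rank rho vanishes on a real subspace of codimension at most rho / 2
    ([isotropic_kernel]); there the correction disappears altogether, which costs
    m2 / 2 dimensions and serves the upper and the lower bounds at once.  This
    gives a common compression of [A] and [Ainv] of dimension at least
    k - m1 - m2 / 2 ([Ainv_compression]).

    Poles and zeros.  Multiplicities are read off arbitrary realizations, so a
    realization (M, D, B, A) of F is compared directly with a realization
    (M', D', B', A') of its inverse, without passing through [Ainv].  For real
    positive z and w,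
    F(z) + F(w)^T = (z + w) (M + B^T (w + A)^-1 (z - A)^-1 B),
    so the Gram matrix of the states reached from inputs that grow exponentially at
    real rates is determined by inputs and outputs alone, up to a term in M
    ([gram_sum]).  The inverse system exchanges inputs and outputs, hence it
    produces the same Gram matrix, up to terms in M and M' ([gram_feed]).  Where
    the total input u and the total output y satisfy u M = 0 and y M' = 0, the Gram
    matrices agree and the two forms differ by - v D v^T with v = u + y D' in ker M
    ([form_feed]); this uses the relations that F^-1 F = 1 imposes on M, D, M', D'
    as z tends to infinity ([inverse_asymptotics]).  The form D on ker M has rank
    at most m - rank M - rank M' ([skew_rank_on_kernel]), hence vanishes on a
    subspace of ker M whose codimension in ker M is at most half of that.
    Altogether there is a common compression with n + n' - 2r <= m
    ([inverse_common_compression]), and [gap_count] bounds the multiplicities in a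
    gap by m.  The same Gram matrix argument for two realizations of one function
    makes their state matrices orthogonally similar ([same_transfer_conjugate]), so
    multiplicities do not depend on the realization. *)

(** * Isotropic subspaces of skew-symmetric forms *)

Lemma mxrank_row_mx (K : fieldType) p q s (X : 'M[K]_(p, q)) (Y : 'M_(p, s)) :
  (\rank (row_mx X Y) <= \rank X + \rank Y)%N.
Proof.
rewrite -mxrank_tr tr_row_mx -addsmxE.
by apply: leq_trans (mxrank_adds_leqif _ _) _; rewrite !mxrank_tr.
Qed.

Section Isotropic.
Variable (K : numFieldType).

Lemma skew_form_diag n (S : 'M[K]_n) (x : 'rV[K]_n) :
  S^T = - S -> x *m S *m x^T = 0.
Proof.
move=> hS; have h : (x *m S *m x^T)^T = - (x *m S *m x^T).
  by rewrite !trmx_mul trmxK hS mulNmx mulmxN mulmxA.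
apply/matrixP=> i j; rewrite !ord1; have /matrixP/(_ 0 0) := h.
rewrite !mxE => /eqP; rewrite -addr_eq0 -mulr2n mulrn_eq0 /= => /eqP e.
exact: e.
Qed.

(** An isotropic space that does not contain its own annihilator can be enlarged
    by any missing vector of the annihilator, because a skew-symmetric form
    vanishes on the diagonal; [k] bounds the number of enlargements left. *)
Lemma isotropic_extend n (S : 'M[K]_n) : S^T = - S ->
  forall k p (U : 'M[K]_(p, n)), (n - \rank U <= k)%N -> U *m S *m U^T = 0 ->
  exists q (W : 'M[K]_(q, n)),
    W *m S *m W^T = 0 /\ (kermx (S *m W^T) <= W)%MS.
Proof.
move=> hS; elim=> [|k IH] p U hk hU.
  exists p, U; split=> //; apply: submx_full.
  by rewrite /row_full eqn_leq rank_leq_col -subn_eq0 -leqn0.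
have [?|/row_subPn[i hi]] := boolP (kermx (S *m U^T) <= U)%MS; first by exists p, U.
set x := row i _ in hi.
have hx : x *m S *m U^T = 0 by rewrite -mulmxA -row_mul mulmx_ker row0.
have hx' : U *m S *m x^T = 0.
  by apply: trmx_inj; rewrite !trmx_mul trmxK hS mulNmx mulmxN mulmxA hx trmx0 oppr0.
apply: (IH _ (col_mx U x)); last first.
  rewrite mul_col_mx tr_col_mx mul_col_row hU hx hx' skew_form_diag //.
  exact: block_mx0.
have lt : (\rank U < \rank (col_mx U x))%N.
  apply: rank_ltmx; rewrite /ltmx col_mx_sub submx_refl hi andbT.
  by apply: submx_trans (addsmxSl U x) _; rewrite addsmxE.
by have := rank_leq_col (col_mx U x); move: hk lt; lia.
Qed.

(** A maximal isotropic space W equals its annihilator and contains the radical,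
    and counting dimensions gives 2 (n - dim W) = rank S.  The space is returned as
    the kernel of [N], since it is used as a constraint.  Being real, its
    complexification is isotropic for the Hermitian form attached to S, so one
    subspace bounds both the positive and the negative index. *)
Lemma isotropic_kernel n (S : 'M[K]_n) : S^T = - S ->
  exists2 N : 'M[K]_n, (\rank N <= (\rank S)./2)%N
    & forall r (X : 'M[K]_(r, n)), X *m N = 0 -> X *m S *m X^T = 0.
Proof.
move=> hS.
have [|q [W [hW hmax]]] := isotropic_extend hS (leqnn _) (U := 0 : 'M_(0, n)).
  by rewrite !mul0mx.
exists (cokermx W); last first.
  move=> r X /eqP; rewrite -submxE => /submxP [Y ->].
  by rewrite trmx_mul mulmxA -(mulmxA Y) -(mulmxA Y) hW mulmx0 mul0mx.
rewrite mxrank_coker geq_half_double.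
have hker : (kermx S <= W)%MS.
  by apply: submx_trans hmax; rewrite sub_kermx mulmxA mulmx_ker mul0mx.
have e1 : (\rank (W *m S) + \rank (W :&: kermx S)%MS)%N = \rank W.
  exact: mxrank_mul_ker.
have e2 : (n - \rank S <= \rank (W :&: kermx S))%N.
  by rewrite -mxrank_ker; apply: mxrankS; rewrite sub_capmx hker submx_refl.
have e3 : \rank (S *m W^T) = \rank (W *m S).
  by rewrite -mxrank_tr trmx_mul trmxK hS mulmxN mxrank_opp.
have := mxrankS hmax; rewrite mxrank_ker e3 -mul2n.
by have := rank_leq_col W; have := rank_leq_col S; move: e1 e2; lia.
Qed.

End Isotropic.

(** * The spectrum of a real skew-symmetric matrix *)

Lemma hermitian_spectral_decomposition (C : numClosedFieldType) n (H : 'M[C]_n) :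
  H \is hermsymmx ->
  H = (map_mx Num.conj (spectralmx H)^T) *m diag_mx (spectral_diag H) *m spectralmx H.
Proof.
move=> /hermitian_normalmx /orthomx_spectralP {1}->.
by rewrite invmx_unitary // spectral_unitarymx.
Qed.

Section Spectrum.
Variable R : realType.
Local Notation C := R[i].

Lemma conj_real (x : R) : Num.conj (x%:C%C : C) = x%:C%C.
Proof. exact: conjc_real. Qed.

Lemma conj_i : Num.conj ('i%C : C) = - 'i%C.
Proof. by rewrite complexiE conjCi. Qed.

Lemma sqr_iC : ('i%C : C) * 'i%C = -1.
Proof. by rewrite -expr2 sqr_i. Qed.

Lemma cmxM p q s (X : 'M[R]_(p, q)) (Y : 'M_(q, s)) :
  cmx (X *m Y) = cmx X *m cmx Y.
Proof. exact: map_mxM. Qed.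

Lemma ctrmxM p q s (X : 'M[C]_(p, q)) (Y : 'M_(q, s)) :
  ctrmx (X *m Y) = ctrmx Y *m ctrmx X.
Proof. by rewrite /ctrmx trmx_mul map_mxM. Qed.

Lemma ctrmxK p q (X : 'M[C]_(p, q)) : ctrmx (ctrmx X) = X.
Proof. exact: trmxCK. Qed.

Lemma ctrmx_cmx p q (X : 'M[R]_(p, q)) : ctrmx (cmx X) = cmx X^T.
Proof. by apply/matrixP=> i j; rewrite !mxE conj_real. Qed.

(** The spectral decomposition of iA, keeping the eigenvalues as an unordered
    family of reals: counting arguments need no ordering. *)
Definition diagonalizes n (U : 'M[C]_n) (d : 'I_n -> R) (A : 'M[R]_n) : Prop :=
  U *m ctrmx U = 1%:M /\
  imx A = ctrmx U *m diag_mx (\row_i (d i)%:C%C) *m U.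

Lemma skew_diagonalizable n (A : 'M[R]_n) : A^T = - A ->
  exists U d, diagonalizes U d A.
Proof.
move=> hA; have hH : imx A \is hermsymmx.
  apply/is_hermitianmxP; rewrite expr0 scale1r.
  apply/matrixP=> i j; have /matrixP/(_ i j) := hA; rewrite !mxE => h.
  by rewrite rmorphM /= conj_i conj_real h rmorphN /= mulrNN.
exists (spectralmx (imx A)), (fun i => complex.Re (spectral_diag (imx A) 0 i)).
have hU := spectral_unitarymx (imx A); split; first exact/unitarymxP.
rewrite [LHS](hermitian_spectral_decomposition hH); congr (_ *m diag_mx _ *m _).
apply/rowP=> i; rewrite mxE RRe_real //.
by have /mxOverP := hermitian_spectral_diag_real hH; apply.
Qed.

Section Diagonal.
Variables (n : nat) (A : 'M[R]_n) (U : 'M[C]_n) (d : 'I_n -> R).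
Hypothesis hU : diagonalizes U d A.

Lemma diagonalizes_unitl : U *m ctrmx U = 1%:M. Proof. by case: hU. Qed.
Lemma diagonalizes_unitr : ctrmx U *m U = 1%:M.
Proof. exact: mulmx1C diagonalizes_unitl. Qed.

Lemma form_diag (x : 'rV[C]_n) :
  (x *m imx A *m ctrmx x) 0 0
    = \sum_i (d i)%:C%C * `|(x *m ctrmx U) 0 i| ^+ 2.
Proof.
have -> : x *m imx A *m ctrmx x = (x *m ctrmx U) *m
    diag_mx (\row_i (d i)%:C%C) *m ctrmx (x *m ctrmx U).
  by rewrite hU.2 ctrmxM ctrmxK !mulmxA.
rewrite mxE; apply: eq_bigr => i _; rewrite mul_mx_diag !mxE.
by rewrite normCK mulrAC mulrC mulrCA mulrA.
Qed.

Lemma norm_diag (x : 'rV[C]_n) :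
  (x *m ctrmx x) 0 0 = \sum_i `|(x *m ctrmx U) 0 i| ^+ 2.
Proof.
have -> : x *m ctrmx x = (x *m ctrmx U) *m ctrmx (x *m ctrmx U).
  by rewrite ctrmxM ctrmxK mulmxA -(mulmxA x) diagonalizes_unitr mulmx1.
by rewrite mxE; apply: eq_bigr => i _; rewrite !mxE normCK.
Qed.

Lemma char_poly_diag : char_poly (imx A) = \prod_i ('X - (d i)%:C%C%:P).
Proof.
pose L := map_mx polyC (ctrmx U); pose V := map_mx polyC U.
have LV : L *m V = 1%:M by rewrite -map_mxM diagonalizes_unitr map_mx1.
have -> : char_poly (imx A) = \det (L *m char_poly_mx (diag_mx (\row_i (d i)%:C%C)) *m V).
  congr (\det _); rewrite /char_poly_mx hU.2 !map_mxM -/L -/V mulmxBr mulmxBl.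
  by rewrite mul_mx_scalar -scalemxAl LV scalemx1.
rewrite !det_mulmx mulrAC -det_mulmx LV det1 mul1r -/(char_poly _) char_poly_trig.
  by apply: eq_bigr => i _; rewrite !mxE eqxx mulr1n.
exact: diag_mx_is_trig.
Qed.

Lemma perm_eigvals : perm_eq (eigvals (imx A)) [seq d i | i <- enum 'I_n].
Proof.
rewrite /eigvals perm_sort; case: closed_field_poly_normal => s /= hs.
have : perm_eq s [seq (d i)%:C%C | i <- enum 'I_n].
  apply: prod_XsubC_eq; rewrite big_map big_enum -char_poly_diag hs.
  by rewrite (monicP (char_poly_monic _)) scale1r.
by move=> /(perm_map (@complex.Re R)); rewrite -map_comp.
Qed.

Lemma count_eigvals (p : pred R) : count p (eigvals (imx A)) = #|[pred i | p (d i)]|.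
Proof.
have /permP-> := perm_eigvals.
by rewrite count_map -size_filter cardE /enum_mem filter_predT size_filter -enumT
  -size_filter.
Qed.

Lemma size_eigvals : size (eigvals (imx A)) = n.
Proof. by rewrite (perm_size perm_eigvals) size_map size_enum_ord. Qed.

End Diagonal.

Lemma mxrank_diag_le (F : fieldType) n (e : 'rV[F]_n) :
  (\rank (diag_mx e) <= #|[pred i : 'I_n | e 0%R i != 0%R]|)%N.
Proof.
rewrite diag_mx_sum_delta (bigID (fun i : 'I_n => e 0 i != 0)) /= addrC big1 ?add0r; last first.
  by move=> i /negPn/eqP ->; rewrite scale0r.
rewrite -sum1_card; elim/big_rec2: _ => [|i k M _ IH]; first by rewrite mxrank0.
apply: leq_trans (mxrank_add _ _) _; apply: leq_add IH.
by apply: leq_trans (mxrank_scale _ _) _; rewrite mxrank_delta.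
Qed.

(** Adding ones at the vanishing diagonal entries makes the matrix invertible, so
    the upper bound for the rank of each of the two summands is attained. *)
Lemma mxrank_diag (F : fieldType) n (e : 'rV[F]_n) :
  \rank (diag_mx e) = #|[pred i : 'I_n | e 0 i != 0]|.
Proof.
apply/eqP; rewrite eqn_leq mxrank_diag_le /=.
pose e' : 'rV[F]_n := \row_i (e 0 i == 0)%:R.
have hfull : \rank (diag_mx e + diag_mx e')%R = n.
  have -> : diag_mx e + diag_mx e' = diag_mx (e + e').
    by apply/matrixP=> i j; rewrite !mxE mulrnDl.
  apply: mxrank_unit; rewrite unitmxE det_diag unitfE.
  apply/prodf_neq0 => i _; rewrite !mxE.
  by have [->|h] := eqVneq (e 0 i) 0; rewrite ?add0r ?oner_eq0 // addr0.
have h1 := mxrank_add (diag_mx e) (diag_mx e').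
have h2 := mxrank_diag_le e'.
have h3 : #|[pred i : 'I_n | e' 0 i != 0]| = #|[predC [pred i : 'I_n | e 0 i != 0]]|.
  by apply: eq_card => i; rewrite !inE !mxE negbK; case: (e 0 i == 0);
     rewrite /= ?oner_eq0 ?eqxx.
rewrite h3 in h2; rewrite hfull in h1.
rewrite -(leq_add2r #|[predC [pred i : 'I_n | e 0%R i != 0%R]]|) cardC card_ord.
by apply: leq_trans h1 _; rewrite leq_add2l.
Qed.

(** The sign comes from the factor i: A has eigenvalue iw exactly when iA has
    eigenvalue -w. *)
Lemma rank_eigenspace n (A : 'M[R]_n) U d (w : R) : diagonalizes U d A ->
  \rank (eigenspace (cmx A) (iR w)) = #|[pred i | d i == - w]|.
Proof.
move=> hU; pose e : 'rV[C]_n := \row_i ((d i + w)%:C%C : C).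
have hUl : U \in unitmx by case/mulmx1_unit: (diagonalizes_unitl hU).
have hUr : ctrmx U \in unitmx by case/mulmx1_unit: (diagonalizes_unitl hU).
have hA : cmx A - (iR w)%:M = - 'i%C *: (ctrmx U *m diag_mx e *m U).
  have -> : cmx A = - 'i%C *: imx A.
    by rewrite /imx scalerA mulNr sqr_iC opprK scale1r.
  have -> : diag_mx e = diag_mx (\row_i (d i)%:C%C) + (w%:C%C)%:M.
    apply/matrixP=> i j; rewrite !mxE -mulrnDl; case: (i == j) => //=.
    by rewrite !mulr1n rmorphD.
  rewrite mulmxDr mulmxDl -hU.2 mul_mx_scalar -scalemxAl (diagonalizes_unitr hU).
  by rewrite scalerDr scalemx1 /iR scale_scalar_mx mulNr raddfN.
rewrite /eigenspace mxrank_ker hA mxrank_scale_nz; last first.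
  by rewrite oppr_eq0 eq_complex /= oner_eq0 andbF.
rewrite mxrankMfree ?row_free_unit // -mxrank_tr trmx_mul mxrankMfree; last first.
  by rewrite row_free_unit unitmx_tr.
rewrite mxrank_tr mxrank_diag.
have -> : #|[pred i | d i == - w]| = #|[predC [pred i : 'I_n | e 0 i != 0]]|.
  apply: eq_card => i; rewrite !inE mxE negbK.
  by rewrite -(inj_eq (@complexI R)) rmorphN /= -addr_eq0 rmorphD.
by have /eqP := cardC [pred i : 'I_n | e 0 i != 0]; rewrite card_ord => /eqP {1}<-; rewrite addKn.
Qed.

Lemma colsub_enum_eq0 (F : nmodType) r n (a : {pred 'I_n}) (M : 'M[F]_(r, n)) :
  colsub (@enum_val _ a) M = 0 -> forall i j, j \in a -> M i j = 0.
Proof.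
move=> h i j hj; have /matrixP/(_ i (enum_rank_in hj j)) := h.
by rewrite !mxE enum_rankK_in.
Qed.

(** Collect the coordinates of cQ along the eigenvectors of iA' with eigenvalue
    above t and those of cP along the eigenvectors of iA with eigenvalue at most
    t.  If all of them vanish, the form of iA - t is positive at cP unless cP = 0,
    while the same number computed with iA' - t at cQ is nonpositive; so c = 0.
    The collected coordinates therefore give an injective map on the space of all
    c. *)
Lemma spectral_comparison n n' r (A : 'M[R]_n) (A' : 'M[R]_n')
    U d U' d' (P : 'M[R]_(r, n)) (Q : 'M[R]_(r, n')) (t : R) :
  diagonalizes U d A -> diagonalizes U' d' A' -> row_free P ->
  P *m P^T = Q *m Q^T -> P *m A *m P^T = Q *m A' *m Q^T ->
  (r <= #|[pred i | (t < d' i)%R]| + #|[pred i | (d i <= t)%R]|)%N.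
Proof.
move=> hU hU' hP hN hF.
pose p := cmx P *m ctrmx U; pose q := cmx Q *m ctrmx U'.
set a := [pred i | (t < d' i)%R]; set b := [pred i | (d i <= t)%R].
pose M := row_mx (colsub (@enum_val _ a) q) (colsub (@enum_val _ b) p).
suff : row_free M by move/eqP <-; exact: rank_leq_col.
rewrite -kermx_eq0; apply/rowV0P => c /sub_kermxP.
rewrite mul_mx_row => hM; have {hM} [h1 h2] :
    colsub (@enum_val _ a) (c *m q) = 0 /\ colsub (@enum_val _ b) (c *m p) = 0.
  by move: hM; rewrite -[0]row_mx0 => /eq_row_mx [<- <-]; rewrite -!mulmx_colsub.
have {h1} y0 j := colsub_enum_eq0 h1 0 (j := j).
have {h2} x0 j := colsub_enum_eq0 h2 0 (j := j).
have eN : \sum_i `|(c *m p) 0 i| ^+ 2 = \sum_i `|(c *m q) 0 i| ^+ 2.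
  rewrite /p /q !(mulmxA c) -(norm_diag hU) -(norm_diag hU') !ctrmxM !mulmxA.
  rewrite -!(mulmxA c) !ctrmx_cmx.
  by rewrite -!cmxM hN.
have eF : \sum_i (d i)%:C%C * `|(c *m p) 0 i| ^+ 2
        = \sum_i (d' i)%:C%C * `|(c *m q) 0 i| ^+ 2.
  rewrite /p /q !(mulmxA c) -(form_diag hU) -(form_diag hU') !ctrmxM !mulmxA.
  rewrite -!(mulmxA c) !ctrmx_cmx.
  by rewrite /imx -!scalemxAr -!scalemxAl -!cmxM hF.
have e : \sum_i (d i - t)%:C%C * `|(c *m p) 0 i| ^+ 2
       = \sum_i (d' i - t)%:C%C * `|(c *m q) 0 i| ^+ 2.
  have sE m (f : 'I_m -> R) (g : 'I_m -> C) : \sum_i (f i - t)%:C%C * g i =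
      \sum_i (f i)%:C%C * g i - t%:C%C * \sum_i g i.
    by rewrite mulr_sumr -sumrB; apply: eq_bigr => i _; rewrite rmorphB mulrBl.
  by rewrite !sE eN eF.
have pos i : 0 <= (d i - t)%:C%C * `|(c *m p) 0 i| ^+ 2.
  have [h|h] := leP (d i) t; first by rewrite x0 ?inE // normr0 expr0n mulr0.
  by rewrite mulr_ge0 ?exprn_ge0 // ler0c subr_ge0 ltW.
have neg : \sum_i (d i - t)%:C%C * `|(c *m p) 0 i| ^+ 2 <= 0.
  rewrite e; apply: sumr_le0 => i _.
  have [h|h] := leP (d' i) t; last by rewrite y0 ?inE // normr0 expr0n mulr0.
  by rewrite mulr_le0_ge0 ?exprn_ge0 // -oppr_ge0 -rmorphN ler0c opprB subr_ge0.
have /eqP : \sum_i (d i - t)%:C%C * `|(c *m p) 0 i| ^+ 2 = 0.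
  by apply/eqP; rewrite eq_le neg sumr_ge0.
rewrite psumr_eq0 // => /allP /= hz.
have cp0 : c *m p = 0.
  apply/rowP=> i; rewrite [RHS]mxE; have [h|h] := leP (d i) t; first by rewrite x0 ?inE.
  have := hz i (mem_index_enum i); rewrite mulf_eq0 => /orP[|].
    by rewrite -(rmorph0 (real_complex R)) (inj_eq (@complexI R)) subr_eq0 gt_eqF.
  by rewrite expf_eq0 /= normr_eq0 => /eqP.
have : c *m cmx P = 0.
  by rewrite -[cmx P]mulmx1 -(diagonalizes_unitr hU) !mulmxA -(mulmxA c) cp0 mul0mx.
have hPc : row_free (cmx P) by rewrite /row_free /cmx mxrank_map.
by move/eqP; rewrite mulmx_free_eq0 // => /eqP.
Qed.

End Spectrum.

(** * Interlacing from a common compression *)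

Section Interlacing.
Variable R : realType.

Definition common_compression n n' (r : nat) (A : 'M[R]_n) (A' : 'M[R]_n') : Prop :=
  exists (P : 'M[R]_(r, n)) (Q : 'M[R]_(r, n')),
    [/\ row_free P, row_free Q, P *m P^T = Q *m Q^T
      & P *m A *m P^T = Q *m A' *m Q^T].

Lemma common_compression_sym n n' r (A : 'M[R]_n) (A' : 'M[R]_n') :
  common_compression r A A' -> common_compression r A' A.
Proof. by case=> P [Q [? ? ? ?]]; exists Q, P. Qed.

Lemma common_compression_refl n (A : 'M[R]_n) : common_compression n A A.
Proof. by exists 1%:M, 1%:M; rewrite row_free_unit unitmx1. Qed.

Lemma sum_sqr_eq0 n (x : 'rV[R]_n) : x *m x^T = 0 -> x = 0.
Proof.
move=> /matrixP/(_ 0 0); rewrite !mxE => /eqP.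
under eq_bigr do rewrite mxE -expr2.
rewrite psumr_eq0 => [/allP h|i _]; last exact: sqr_ge0.
apply/rowP=> i; have := h i (mem_index_enum i); rewrite expf_eq0 /= => /eqP ->.
by rewrite mxE.
Qed.

Lemma gram_ker r n n' (P : 'M[R]_(r, n)) (Q : 'M[R]_(r, n')) (x : 'rV_r) :
  P *m P^T = Q *m Q^T -> x *m P = 0 -> x *m Q = 0.
Proof.
move=> h hx; apply: sum_sqr_eq0.
by rewrite trmx_mul mulmxA -(mulmxA x) -h mulmxA hx !mul0mx.
Qed.

Lemma gram_row_free r n n' (P : 'M[R]_(r, n)) (Q : 'M[R]_(r, n')) :
  P *m P^T = Q *m Q^T -> row_free P -> row_free Q.
Proof.
move=> h hP; rewrite -kermx_eq0; apply/rowV0P => x /sub_kermxP hx.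
by have /eqP := gram_ker (esym h) hx; rewrite mulmx_free_eq0 // => /eqP.
Qed.

(** With t the [j']-th eigenvalue of iA', [spectral_comparison] provides at least
    [j] eigenvalues of iA that are at most t. *)
Lemma lambda_le n n' r (A : 'M[R]_n) (A' : 'M[R]_n') (j j' : int) :
  A^T = - A -> A'^T = - A' -> common_compression r A A' ->
  j + n'%:Z - r%:Z <= j' -> (lambda (imx A) j <= lambda (imx A') j')%E.
Proof.
move=> /skew_diagonalizable [U [d hU]] /skew_diagonalizable [U' [d' hU']].
move=> [P [Q [fP _ hN hF]]] hj; rewrite /lambda.
have [//|j1] := ltP j 1; first by rewrite leNye.
have hrn' : (r <= n')%N.
  by have := gram_row_free hN fP; move/eqP <-; exact: rank_leq_col.
have -> : (j' < 1) = false by apply/negbTE; rewrite -leNgt; move: hj j1 hrn'; lia.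
have [|j'n] := ltP n'%:Z j'; first by rewrite leey.
have s' : sorted <=%R (eigvals (imx A')) by exact: sort_le_sorted.
have s : sorted <=%R (eigvals (imx A)) by exact: sort_le_sorted.
set t := (eigvals (imx A'))`_(`|j'|%N.-1).
have hc := spectral_comparison t hU hU' fP hN hF.
have hc' : (`|j'| <= #|[pred i | (d' i <= t)%R]|)%N.
  rewrite -(count_eigvals hU' (fun x => x <= t)) leqNgt; apply/negP => hlt.
  suff : t < t by rewrite ltxx.
  apply: nth_count_gt => //; rewrite (size_eigvals hU').
  have hj' : (0 < `|j'| <= n')%N by move: hj j1 j'n hrn'; lia.
  case/andP: hj' => j'0 j'n'; apply/andP; split; last by rewrite prednK.
  by rewrite -ltnS prednK //; exact: hlt.
have hn : #|[pred i | (t < d' i)%R]| = (n' - #|[pred i | (d' i <= t)%R]|)%N.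
  have /eqP := cardC [pred i | (d' i <= t)%R]; rewrite card_ord => /eqP h.
  rewrite -[X in (X - _)%N]h addKn.
  by apply: eq_card => i; rewrite !inE ltNge.
have hc1 : (`|j| <= #|[pred i | (d i <= t)%R]|)%N.
  by move: hc hc' hj j1 j'n; rewrite hn; lia.
have hjn : (#|[pred i | (d i <= t)%R]| <= n)%N.
  by apply: leq_trans (max_card _) _; rewrite card_ord.
have -> : (n%:Z < j) = false by apply/negbTE; rewrite -leNgt; lia.
rewrite lee_fin; apply: nth_count_le => //.
have := leq_trans hc1 (eq_leq (esym (count_eigvals hU (fun x => x <= t)))).
by apply: leq_trans; move: j1; lia.
Qed.

End Interlacing.

(** * The compression relating [A] and [Ainv] *)

Section Bordered.
Variable R : realType.

Lemma skew_invmx n (S : 'M[R]_n) : S^T = - S -> (invmx S)^T = - invmx S.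
Proof.
move=> hS; rewrite trmx_inv hS.
have hu : (- S \in unitmx) = (S \in unitmx) by rewrite -[S in RHS]trmxK hS unitmx_tr.
have [u|u] := boolP (S \in unitmx); last first.
  by rewrite (invmx_out u) invmx_out // inE hu.
apply: (can_inj (mulKmx u)); rewrite mulmxN mulmxV // -[S in S *m _]opprK.
by rewrite mulNmx mulmxV // hu.
Qed.

Lemma skew_congr n p (S : 'M[R]_n) (X : 'M[R]_(p, n)) :
  S^T = - S -> (X *m S *m X^T)^T = - (X *m S *m X^T).
Proof. by move=> hS; rewrite !trmx_mul trmxK hS mulNmx mulmxN mulmxA. Qed.

Lemma skew_congr_l n p (S : 'M[R]_n) (X : 'M[R]_(n, p)) :
  S^T = - S -> (X^T *m S *m X)^T = - (X^T *m S *m X).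
Proof. by move=> hS; rewrite -{2 4}[X]trmxK; exact: skew_congr. Qed.

Lemma Ainv_skew n m m1 m2 k (D : 'M[R]_m) (B : 'M[R]_(n, m)) (A : 'M[R]_n)
    (V1 : 'M[R]_(m, m1)) (V2 : 'M[R]_(m, m2)) (K1 : 'M[R]_m1)
    (Gamma : 'M[R]_(n + m1, k)) :
  A^T = - A -> D^T = - D ->
  (Ainv D B A V1 V2 K1 Gamma)^T = - Ainv D B A V1 V2 K1 Gamma.
Proof.
move=> hA hD; rewrite /Ainv.
suff h : (Atilde D B A V1 V2 K1)^T = - Atilde D B A V1 V2 K1.
  exact: skew_congr_l.
rewrite /Atilde; set B1 := B *m V1; set B2 := B *m V2.
set D11 := V1^T *m D *m V1; set D12 := V1^T *m D *m V2.
set S := invmx _; set L := invmx K1.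
have hS : S^T = - S.
  by apply: skew_invmx; exact: skew_congr_l.
have hD11 : D11^T = - D11 by exact: skew_congr_l.
rewrite tr_block_mx opp_block_mx; clearbody B1 B2 S L D11 D12.
have hX p (X : 'M[R]_(p, m2)) : (X *m S *m X^T)^T = - (X *m S *m X^T).
  by exact: skew_congr.
have hY : (L^T *m (- B1^T + D12 *m S *m B2^T))^T = - ((B1 + B2 *m S *m D12^T) *m L).
  rewrite trmx_mul trmxK !raddfD raddfN /= trmxK !trmx_mul trmxK hS.
  by rewrite mulNmx mulmxN mulmxA -opprD mulNmx.
congr block_mx.
- by rewrite raddfB /= hA hX opprB opprK addrC.
- exact: hY.
- by apply: trmx_inj; rewrite raddfN /= hY trmxK opprK.
- rewrite raddfN /=; congr (- _); apply: skew_congr_l.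
  by rewrite raddfD /= hD11 hX opprD.
Qed.

(** The vectors g whose image under Gamma has vanishing last m1 coordinates, and
    first part isotropic for D22^-1 after applying B2: on these, the form of
    [Atilde] reduces to that of [A]. *)
Lemma Ainv_compression n m m1 m2 k (D : 'M[R]_m) (B : 'M[R]_(n, m)) (A : 'M[R]_n)
    (V1 : 'M[R]_(m, m1)) (V2 : 'M[R]_(m, m2)) (K1 : 'M[R]_m1)
    (Gamma : 'M[R]_(n + m1, k)) :
  D^T = - D -> Gamma^T *m Gamma = 1%:M ->
  exists2 r, (k <= r + (m1 + m2./2))%N
    & common_compression r A (Ainv D B A V1 V2 K1 Gamma).
Proof.
move=> hD hG; set S := invmx (V2^T *m D *m V2).
have hS : S^T = - S.
  by apply: skew_invmx; exact: skew_congr_l.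
have [N hN isoN] := isotropic_kernel hS.
pose W := row_mx (rsubmx Gamma^T) (lsubmx Gamma^T *m (B *m V2) *m N).
have hW : (\rank W <= m1 + m2./2)%N.
  apply: leq_trans (mxrank_row_mx _ _) _; apply: leq_add.
    exact: rank_leq_col.
  apply: leq_trans (mxrankM_maxr _ _) _; apply: leq_trans hN _.
  by apply: half_leq; exact: rank_leq_row.
exists (\rank (kermx W)); first by rewrite mxrank_ker; move: hW; lia.
have [Q fQ QW] : exists2 Q : 'M_(\rank (kermx W), k), row_free Q & Q *m W = 0.
  exists (row_base (kermx W)); first exact: row_base_free.
  by apply/sub_kermxP; rewrite eq_row_base.
pose P := lsubmx (Q *m Gamma^T).
move: QW; rewrite mul_mx_row -[0]row_mx0 => /eq_row_mx [Qr QN].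
have QG : Q *m Gamma^T = row_mx P 0.
  by rewrite -[LHS]hsubmxK /P -mulmx_rsub Qr.
have hPQ : P *m P^T = Q *m Q^T.
  have : Q *m Q^T = (Q *m Gamma^T) *m (Q *m Gamma^T)^T.
    by rewrite trmx_mul trmxK mulmxA -(mulmxA Q) hG mulmx1.
  by rewrite QG tr_row_mx mul_row_col trmx0 mulmx0 addr0.
have PBN : P *m (B *m V2) *m N = 0.
  by rewrite /P -mulmx_lsub -!mulmxA; move: QN; rewrite !mulmxA.
exists P, Q; split=> //; last 1 first.
- have -> : Q *m Ainv D B A V1 V2 K1 Gamma *m Q^T
      = (Q *m Gamma^T) *m Atilde D B A V1 V2 K1 *m (Q *m Gamma^T)^T.
    by rewrite trmx_mul trmxK /Ainv !mulmxA.
  rewrite QG tr_row_mx trmx0 /Atilde mul_row_block !mul0mx !addr0 mul_row_col mulmx0 addr0.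
  rewrite mulmxBr mulmxBl; apply/eqP; rewrite -subr_eq0 opprB addrC subrK; apply/eqP.
  by have := isoN _ _ PBN; rewrite trmx_mul !mulmxA.
- by apply: gram_row_free (esym hPQ) _; exact: fQ.
Qed.

End Bordered.

(** * Rational matrix functions at real points *)

Section Evaluation.
Variable R : realType.
Local Notation C := R[i].
Local Notation tofrac := (@FracField.tofrac _).

Lemma tofrac_neq0 (s : {poly C}) z : s.[z] != 0 -> tofrac s != 0.
Proof.
by move=> hs; rewrite tofrac_eq0; apply: contraNneq hs => ->; rewrite horner0.
Qed.

Lemma rf_value_unique (f : ratfun R) (z v w : C) :
  rf_value f z v -> rf_value f z w -> v = w.
Proof.
move=> [p [q [hq hf ->]]] [p' [q' [hq' hf' ->]]].
have : tofrac p / tofrac q == tofrac p' / tofrac q' by rewrite -hf -hf'.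
rewrite eqr_div ?(@tofrac_neq0 _ z) // -!rmorphM /= tofrac_eq => /eqP/(congr1 (horner^~ z)).
by rewrite !hornerM => h; apply/eqP; rewrite eqr_div // h.
Qed.

Lemma rf_valueD (f g : ratfun R) (z v w : C) :
  rf_value f z v -> rf_value g z w -> rf_value (f + g) z (v + w).
Proof.
move=> [p [q [hq -> ->]]] [p' [q' [hq' -> ->]]].
exists (p * q' + p' * q), (q * q'); split; first by rewrite hornerM mulf_neq0.
  by rewrite addf_div ?(@tofrac_neq0 _ z) // rmorphD !rmorphM.
by rewrite addf_div // !(hornerD, hornerM).
Qed.

Lemma rf_valueM (f g : ratfun R) (z v w : C) :
  rf_value f z v -> rf_value g z w -> rf_value (f * g) z (v * w).
Proof.
move=> [p [q [hq -> ->]]] [p' [q' [hq' -> ->]]].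
exists (p * p'), (q * q'); split; first by rewrite hornerM mulf_neq0.
  by rewrite mulf_div !rmorphM.
by rewrite mulf_div !hornerM.
Qed.

Lemma rf_value_poly (p : {poly C}) (z : C) : rf_value (tofrac p) z p.[z].
Proof.
by exists p, 1; rewrite hornerC oner_neq0 rmorph1 !divr1.
Qed.

Lemma rf_value_const (c z : C) : rf_value (const_rf c) z c.
Proof. by rewrite -[X in rf_value _ _ X](hornerC c z); exact: rf_value_poly. Qed.

Lemma rf_value_var (z : C) : rf_value (var_rf R) z z.
Proof. by rewrite -[X in rf_value _ _ X](hornerX z); exact: rf_value_poly. Qed.

Lemma rf_value_nat (k : nat) (z : C) : rf_value k%:R z k%:R.
Proof.
have := rf_value_poly k%:R z.
by rewrite rmorph_nat -[X in X.[z]]polyC_natr hornerC.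
Qed.

(** [mx_value] for rectangular matrices, as needed for the factors of a product. *)
Definition mx_evaluates p q (F : 'M[ratfun R]_(p, q)) (z : C) (V : 'M[C]_(p, q)) : Prop :=
  forall i j, rf_value (F i j) z (V i j).

Lemma mx_evaluates_unique p q (F : 'M[ratfun R]_(p, q)) z V W :
  mx_evaluates F z V -> mx_evaluates F z W -> V = W.
Proof. by move=> hV hW; apply/matrixP=> i j; apply: rf_value_unique (hV i j) (hW i j). Qed.

Lemma mx_evaluatesD p q (F G : 'M[ratfun R]_(p, q)) z V W :
  mx_evaluates F z V -> mx_evaluates G z W -> mx_evaluates (F + G) z (V + W).
Proof. by move=> hV hW i j; rewrite !mxE; apply: rf_valueD. Qed.

Lemma mx_evaluatesM p q s (F : 'M[ratfun R]_(p, q)) (G : 'M_(q, s)) z V W :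
  mx_evaluates F z V -> mx_evaluates G z W -> mx_evaluates (F *m G) z (V *m W).
Proof.
move=> hV hW i j; rewrite !mxE.
apply: (big_ind2 (fun f v => rf_value f z v)) => [||k _].
- exact: (rf_value_nat 0).
- by move=> *; apply: rf_valueD.
- exact: rf_valueM.
Qed.

Lemma mx_evaluatesZ p q f (G : 'M[ratfun R]_(p, q)) z v W :
  rf_value f z v -> mx_evaluates G z W -> mx_evaluates (f *: G) z (v *: W).
Proof. by move=> hV hW i j; rewrite !mxE; apply: rf_valueM. Qed.

Lemma mx_evaluates_const p q (X : 'M[R]_(p, q)) z : mx_evaluates (ratmx X) z (cmx X).
Proof. by move=> i j; rewrite !mxE; exact: rf_value_const. Qed.

Lemma mx_evaluates_poly p q (P : 'M[{poly C}]_(p, q)) z :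
  mx_evaluates (map_mx tofrac P) z (map_mx (horner^~ z) P).
Proof. by move=> i j; rewrite !mxE; exact: rf_value_poly. Qed.

Lemma mx_evaluates_1 n z : mx_evaluates (1%:M : 'M[ratfun R]_n) z 1%:M.
Proof. by move=> i j; rewrite !mxE; exact: rf_value_nat. Qed.

Lemma mx_evaluatesN p q (F : 'M[ratfun R]_(p, q)) z V :
  mx_evaluates F z V -> mx_evaluates (- F) z (- V).
Proof.
move=> h i j; rewrite !mxE -[- F i j]mulN1r -[- V i j]mulN1r; apply: rf_valueM (h i j).
have := rf_value_poly (- 1%:P) z.
by rewrite rmorphN !hornerE [in X in rf_value X]/= rmorph1.
Qed.

Lemma mx_evaluates_tr p q (F : 'M[ratfun R]_(p, q)) z V :
  mx_evaluates F z V -> mx_evaluates F^T z V^T.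
Proof. by move=> h i j; rewrite !mxE. Qed.

(** If x A = z x then z x x^T = x A x^T = 0. *)
Lemma skew_resolvent_unit n (A : 'M[R]_n) (z : R) :
  A^T = - A -> z != 0 -> z%:M - A \in unitmx.
Proof.
move=> hA hz; rewrite -row_free_unit -kermx_eq0; apply/rowV0P => x /sub_kermxP.
rewrite mulmxBr mul_mx_scalar => /eqP; rewrite subr_eq0 => /eqP h.
apply: sum_sqr_eq0; have := skew_form_diag x hA; rewrite -h -scalemxAl => /eqP.
by rewrite scaler_eq0 (negbTE hz) => /eqP.
Qed.

Definition transfer n m (M D : 'M[R]_m) (B : 'M[R]_(n, m)) (A : 'M[R]_n) (z : R) :=
  z *: M + D + B^T *m invmx (z%:M - A) *m B.

(** By Cramer's rule the entries are polynomials divided by the characteristic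
    polynomial, which does not vanish at a nonzero real point; the value is then
    the only possible left inverse of z - A. *)
Lemma mx_evaluates_resolvent n (A : 'M[R]_n) (z : R) : A^T = - A -> z != 0 ->
  mx_evaluates (invmx ((var_rf R)%:M - ratmx A)) z%:C%C (cmx (invmx (z%:M - A))).
Proof.
move=> hA hz.
have eX : (var_rf R)%:M - ratmx A = map_mx tofrac (char_poly_mx (cmx A)).
  by rewrite /char_poly_mx map_mxB map_scalar_mx -map_mx_comp.
have chi_z : (char_poly (cmx A)).[z%:C%C] != 0.
  have -> : cmx A = map_mx (real_complex R) A by [].
  rewrite -map_char_poly horner_map fmorph_eq0 -[_ == 0]/(root _ z) -eigenvalue_root_char.
  apply/eigenvalueP => -[x hx /negP []]; apply/eqP.
  rewrite -[x](mulmxK (skew_resolvent_unit hA hz)).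
  by rewrite mulmxBr mul_mx_scalar hx subrr mul0mx.
have uX : (var_rf R)%:M - ratmx A \in unitmx.
  rewrite eX unitmxE det_map_mx unitfE tofrac_eq0.
  by apply: contraNneq chi_z; rewrite /char_poly => ->; rewrite horner0.
pose V := (char_poly (cmx A)).[z%:C%C]^-1
  *: map_mx (horner^~ z%:C%C) (\adj (char_poly_mx (cmx A))).
have hV : mx_evaluates (invmx ((var_rf R)%:M - ratmx A)) z%:C%C V.
  rewrite /invmx uX eX -map_mx_adj det_map_mx.
  apply: mx_evaluatesZ (mx_evaluates_poly _ _).
  by exists 1, (char_poly (cmx A)); rewrite hornerC rmorph1 !div1r.
suff <- : V = cmx (invmx (z%:M - A)) by [].
have h1 : mx_evaluates ((var_rf R)%:M - ratmx A) z%:C%C (cmx (z%:M - A)).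
  have -> : cmx (z%:M - A) = z%:C%C *: 1%:M - cmx A.
    by apply/matrixP=> i j; rewrite !mxE rmorphB rmorphMn /= mulr_natr.
  rewrite -(scalemx1 _ (var_rf R)).
  apply: mx_evaluatesD; first by apply: mx_evaluatesZ; [exact: rf_value_var|exact: mx_evaluates_1].
  exact/mx_evaluatesN/mx_evaluates_const.
have := mx_evaluatesM hV h1; rewrite mulVmx // =>
  /mx_evaluates_unique/(_ (@mx_evaluates_1 _ _)) hVA.
have u : cmx (z%:M - A) \in unitmx by rewrite map_unitmx skew_resolvent_unit.
by rewrite /cmx map_invmx -/(cmx _) -[V](mulmxK u) hVA mul1mx.
Qed.

Lemma realization_value n m F (M D : 'M[R]_m) (B : 'M[R]_(n, m)) (A : 'M[R]_n) (z : R) :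
  realization F M D B A -> 0 < z -> mx_evaluates F z%:C%C (cmx (transfer M D B A z)).
Proof.
move=> [_ hA _ _ ->] hz.
have -> : cmx (transfer M D B A z) = z%:C%C *: cmx M + cmx D
    + (cmx B)^T *m cmx (invmx (z%:M - A)) *m cmx B.
  by rewrite /transfer /cmx !map_mxD map_mxZ !map_mxM map_trmx.
apply: mx_evaluatesD; first apply: mx_evaluatesD.
- by apply: mx_evaluatesZ; [exact: rf_value_var | exact: mx_evaluates_const].
- exact: mx_evaluates_const.
apply: mx_evaluatesM (mx_evaluates_const _ _); apply: mx_evaluatesM.
- exact/mx_evaluates_tr/mx_evaluates_const.
- by apply: mx_evaluates_resolvent; rewrite ?gt_eqF.
Qed.

Lemma cmx_inj p q : injective (@cmx R p q).
Proof. exact: map_mx_inj. Qed.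

Lemma transfer_unique n n' m F (M D : 'M[R]_m) (B : 'M[R]_(n, m)) A
    (M' D' : 'M[R]_m) (B' : 'M[R]_(n', m)) A' (z : R) :
  realization F M D B A -> realization F M' D' B' A' -> 0 < z ->
  transfer M D B A z = transfer M' D' B' A' z.
Proof.
move=> h h' hz; apply: cmx_inj.
exact: mx_evaluates_unique (realization_value h hz) (realization_value h' hz).
Qed.

Lemma transfer_inv n n' m F (M D : 'M[R]_m) (B : 'M[R]_(n, m)) A
    (M' D' : 'M[R]_m) (B' : 'M[R]_(n', m)) A' (z : R) :
  \det F != 0 -> realization F M D B A -> realization (invmx F) M' D' B' A' -> 0 < z ->
  transfer M' D' B' A' z *m transfer M D B A z = 1%:M.
Proof.
move=> hF h h' hz; apply: cmx_inj; rewrite cmxM.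
have := mx_evaluatesM (realization_value h' hz) (realization_value h hz).
rewrite mulVmx ?unitmxE ?unitfE // => /mx_evaluates_unique/(_ (@mx_evaluates_1 _ _)) ->.
by rewrite /cmx map_mx1.
Qed.

End Evaluation.

(** * Behaviour at infinity and observability *)

Section Asymptotics.
Variable R : realType.

(** The real points at which transfer functions are sampled: positive, where no
    real skew-symmetric resolvent has a pole, and unbounded, so that they also
    detect the behaviour at infinity. *)
Definition node (i : nat) : R := i.+1%:R.

Lemma node_gt0 i : 0 < node i. Proof. by rewrite ltr0n. Qed.
Lemma node_neq0 i : node i != 0. Proof. by rewrite gt_eqF ?node_gt0. Qed.

Definition bounded_mx p q (f : nat -> 'M[R]_(p, q)) : Prop :=
  exists K, forall k i j, `|f k i j| <= K.

Lemma bounded_const p q (X : 'M[R]_(p, q)) : bounded_mx (fun=> X).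
Proof.
exists (\sum_i \sum_j `|X i j|) => _ i j.
rewrite (bigD1 i) //= (bigD1 j) //= -addrA lerDl addr_ge0 //.
  by apply: sumr_ge0.
by apply: sumr_ge0 => ? _; apply: sumr_ge0.
Qed.

Lemma boundedD p q (f g : nat -> 'M[R]_(p, q)) :
  bounded_mx f -> bounded_mx g -> bounded_mx (fun k => f k + g k).
Proof.
move=> [K hK] [L hL]; exists (K + L) => k i j; rewrite mxE.
by apply: le_trans (ler_normD _ _) _; apply: lerD.
Qed.

Lemma boundedN p q (f : nat -> 'M[R]_(p, q)) :
  bounded_mx f -> bounded_mx (fun k => - f k).
Proof. by move=> [K hK]; exists K => k i j; rewrite mxE normrN. Qed.

Lemma boundedM p q s (f : nat -> 'M[R]_(p, q)) (g : nat -> 'M[R]_(q, s)) :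
  bounded_mx f -> bounded_mx g -> bounded_mx (fun k => f k *m g k).
Proof.
move=> [K hK] [L hL]; exists (\sum_(j < q) K * L) => k i j; rewrite mxE.
apply: le_trans (ler_norm_sum _ _ _) _; apply: ler_sum => l _.
by rewrite normrM; apply: ler_pM.
Qed.

Lemma bounded_shrink p q (f : nat -> 'M[R]_(p, q)) :
  bounded_mx f -> bounded_mx (fun k => (node k)^-1 *: f k).
Proof.
move=> [K hK]; exists K => k i j; rewrite mxE normrM.
apply: le_trans (hK k i j); rewrite ler_piMl //.
by rewrite ger0_norm ?invr_ge0 ?ler0n // invf_le1 ?node_gt0 // ler1n.
Qed.

(** Comparison of orders of growth at infinity: it plays the part of identifying
    the leading coefficients of a Laurent expansion. *)
Lemma bounded_growth0 p q (X : 'M[R]_(p, q)) f :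
  bounded_mx f -> (forall k, node k *: X = f k) -> X = 0.
Proof.
move=> [K hK] hX; apply/matrixP=> i j; rewrite [RHS]mxE; apply/eqP.
have [//|nz] := eqVneq (X i j) 0; exfalso.
have xpos : 0 < `|X i j| by rewrite normr_gt0.
have K0 : 0 <= K by exact: le_trans (normr_ge0 _) (hK 0 i j).
have := hK (Num.bound (K / `|X i j|)) i j; rewrite -hX mxE normrM.
rewrite -ler_pdivlMr // leNgt => /negP; apply.
rewrite (ger0_norm (ler0n _ _)).
apply: lt_le_trans (archi_boundP (divr_ge0 K0 (ltW xpos))) _.
by rewrite ler_nat.
Qed.

Definition resolvent n (A : 'M[R]_n) (k : nat) := invmx ((node k)%:M - A).

Section Resolvent.
Variables (n : nat) (A : 'M[R]_n).
Hypothesis hA : A^T = - A.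

Lemma resolventV k : ((node k)%:M - A) *m resolvent A k = 1%:M.
Proof. by rewrite mulmxV // skew_resolvent_unit // node_neq0. Qed.

Lemma resolventVl k : resolvent A k *m ((node k)%:M - A) = 1%:M.
Proof. by rewrite mulVmx // skew_resolvent_unit // node_neq0. Qed.

Lemma resolventZ k : node k *: resolvent A k = 1%:M + A *m resolvent A k.
Proof. by rewrite -(resolventV k) mulmxBl mul_scalar_mx subrK. Qed.

Lemma resolventZr k : node k *: resolvent A k = 1%:M + resolvent A k *m A.
Proof. by rewrite -(resolventVl k) mulmxBr mul_mx_scalar subrK. Qed.

(** For a row x of the resolvent, z |x|^2 = x (z - A) x^T is the diagonal entry of
    that row, because x A x^T = 0; hence |x|^2 <= 1 when z >= 1. *)
Lemma bounded_resolvent : bounded_mx (resolvent A).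
Proof.
exists 1 => k i j; pose x := row i (resolvent A k).
have hx : node k * (x *m x^T) 0 0 = x 0 i.
  have e : x *m ((node k)%:M - A) = delta_mx 0 i.
    by rewrite -row_mul resolventVl row1.
  have /matrixP/(_ 0 0) : x *m ((node k)%:M - A) *m x^T = delta_mx 0 i *m x^T by rewrite e.
  rewrite mulmxBr mulmxBl (skew_form_diag x hA) subr0 mul_mx_scalar -scalemxAl mxE => ->.
  by rewrite -rowE !mxE.
have sq l : x 0 l ^+ 2 <= x 0 i.
  have -> : x 0 i = node k * \sum_s x 0 s ^+ 2.
    rewrite -[LHS]hx mxE; congr (_ * _); apply: eq_bigr => s _.
    by rewrite [x^T _ _]mxE expr2.
  rewrite (bigD1 l) //=; apply: (@le_trans _ _ (node k * x 0 l ^+ 2)).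
    by rewrite ler_peMl ?sqr_ge0 // ler1n.
  by rewrite ler_wpM2l ?ler0n // lerDl; apply: sumr_ge0 => s _; rewrite sqr_ge0.
have x1 : x 0 i <= 1 by have := sq i; nra.
have := le_trans (sq j) x1; rewrite mxE => h.
by rewrite -(@ler_pXn2r _ 2) // ?nnegrE // expr1n real_normK // num_real.
Qed.

End Resolvent.

(** From z (z - A)^-1 = 1 + A (z - A)^-1. *)
Lemma transfer_expansion n m (M D : 'M[R]_m) (B : 'M[R]_(n, m)) (A : 'M[R]_n) :
  A^T = - A -> exists2 Q, bounded_mx Q
    & forall k, transfer M D B A (node k) = node k *: M + (D + (node k)^-1 *: Q k).
Proof.
move=> hA; exists (fun k => B^T *m (1%:M + A *m resolvent A k) *m B).
  apply: boundedM; last exact: bounded_const.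
  apply: boundedM; first exact: bounded_const.
  apply: boundedD; first exact: bounded_const.
  by apply: boundedM; [exact: bounded_const|exact: bounded_resolvent].
move=> k; rewrite -resolventZ // /transfer addrA; congr (_ + _).
by rewrite -scalemxAr -scalemxAl scalerA mulVf ?node_neq0 // scale1r.
Qed.

(** The coefficients of z^2 and z in F^-1 F = 1 vanish; the constant coefficient
    is D'D up to terms that begin with M' or end with M. *)
Lemma inverse_asymptotics n n' m (M D : 'M[R]_m) (B : 'M[R]_(n, m)) (A : 'M[R]_n)
    (M' D' : 'M[R]_m) (B' : 'M[R]_(n', m)) (A' : 'M[R]_n') :
  A^T = - A -> A'^T = - A' ->
  (forall k, transfer M' D' B' A' (node k) *m transfer M D B A (node k) = 1%:M) ->
  [/\ M' *m M = 0, M' *m D + D' *m M = 0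
    & forall p q (y : 'M_(p, m)) (u : 'M_(m, q)),
        y *m M' = 0 -> M *m u = 0 -> y *m D' *m D *m u = y *m u].
Proof.
move=> hA hA' h.
have [Q bQ hQ] := transfer_expansion M D B hA.
have [Q' bQ' hQ'] := transfer_expansion M' D' B' hA'.
pose G k := D + (node k)^-1 *: Q k; pose G' k := D' + (node k)^-1 *: Q' k.
have bG : bounded_mx G by apply: boundedD (bounded_const _) (bounded_shrink _).
have bG' : bounded_mx G' by apply: boundedD (bounded_const _) (bounded_shrink _).
have e k : node k *: (node k *: (M' *m M)) + node k *: (M' *m G k + G' k *m M) + G' k *m G k = 1%:M.
  rewrite -(h k) hQ hQ' -/(G k) -/(G' k).
  move: (G k) (G' k) => g g'; rewrite mulmxDl !mulmxDr.
  by rewrite -!scalemxAl -!scalemxAr scalerDr !addrA.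
have m0 : M' *m M = 0.
  apply: (@bounded_growth0 _ _ _
      (fun k => (node k)^-1 *: (1%:M - G' k *m G k) - (M' *m G k + G' k *m M))).
    apply: boundedD; [apply: bounded_shrink|apply: boundedN]; apply: boundedD.
    - exact: bounded_const.
    - by apply/boundedN/boundedM.
    - by apply: boundedM => //; exact: bounded_const.
    - by apply: boundedM => //; exact: bounded_const.
  move=> k; rewrite -(e k) addrK scalerDr !scalerA mulVf ?node_neq0 // mulrA.
  by rewrite mulVf ?node_neq0 // mul1r !scale1r addrK.
have e1 k : node k *: (M' *m G k + G' k *m M) + G' k *m G k = 1%:M.
  by rewrite -(e k) m0 !scaler0 add0r.
split=> //.
- apply: (@bounded_growth0 _ _ _
      (fun k => 1%:M - G' k *m G k - (M' *m Q k + Q' k *m M))).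
    apply: boundedD; [|apply: boundedN]; apply: boundedD.
    - exact: bounded_const.
    - by apply/boundedN/boundedM.
    - by apply: boundedM => //; exact: bounded_const.
    - by apply: boundedM => //; exact: bounded_const.
  move=> k; have eG : M' *m G k + G' k *m M =
      (M' *m D + D' *m M) + (node k)^-1 *: (M' *m Q k + Q' k *m M).
    by rewrite /G /G' mulmxDr mulmxDl -scalemxAr -scalemxAl addrACA scalerDr.
  have := e1 k; rewrite eG (scalerDr (node k)) scalerA mulfV ?node_neq0 // scale1r => <-.
  by rewrite addrK addrK.
- move=> p q y u hy hu; apply/eqP; rewrite -subr_eq0; apply/eqP.
  apply: (@bounded_growth0 _ _ _ (fun k =>
    - (y *m (D' *m Q k + Q' k *m G k) *m u))).
    apply: boundedN; apply: boundedM; last exact: bounded_const.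
    apply: boundedM; first exact: bounded_const.
    apply: boundedD; last exact: boundedM.
    by apply: boundedM => //; exact: bounded_const.
  move=> k.
  have : y *m (node k *: (M' *m G k + G' k *m M) + G' k *m G k) *m u = y *m u.
    by rewrite e1 mulmx1.
  have -> : y *m (node k *: (M' *m G k + G' k *m M) + G' k *m G k) *m u = y *m (G' k *m G k) *m u.
    rewrite mulmxDr mulmxDl -scalemxAr -scalemxAl mulmxDr mulmxDl !mulmxA hy !mul0mx add0r.
    by rewrite -(mulmxA _ M) hu mulmx0 scaler0 add0r.
  move=> <-; have -> : G' k *m G k =
      D' *m D + (node k)^-1 *: (D' *m Q k + Q' k *m G k).
    rewrite {1}/G' mulmxDl {1}/G mulmxDr -scalemxAr -scalemxAl -addrA.
    by rewrite (scalerDr _ (D' *m Q k)).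
  rewrite mulmxDr mulmxDl !mulmxA opprD addrA subrr sub0r -scalemxAr -scalemxAl.
  by rewrite scalerN scalerA mulfV ?node_neq0 // scale1r.
Qed.

(** Letting z tend to infinity in z B^T (z - A)^-1 w = z g gives g = 0.  Once
    B^T (z - A)^-1 w = 0, the same limit gives B^T w = 0, and the resolvent
    identity turns the hypothesis for w into the one for A w. *)
Lemma observability n m (B : 'M[R]_(n, m)) (A : 'M[R]_n) :
  A^T = - A -> forall (w : 'cV_n) (g : 'cV_m),
  (forall k, B^T *m resolvent A k *m w = g) ->
  g = 0 /\ forall j, B^T *m (A ^+ j) *m w = 0.
Proof.
move=> hA.
have main (w : 'cV_n) : (forall k, B^T *m resolvent A k *m w = 0) ->
    B^T *m w = 0 /\ forall k, B^T *m resolvent A k *m (A *m w) = 0.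
  move=> hw.
  have e k : B^T *m w = - (B^T *m resolvent A k *m (A *m w)).
    have := hw k => /(congr1 (fun X => node k *: X)).
    rewrite scaler0 scalemxAl scalemxAr resolventZr // mulmxDr mulmx1 mulmxDl.
    by rewrite !mulmxA => /eqP; rewrite addr_eq0 => /eqP.
  have w0 : B^T *m w = 0.
    apply: (@bounded_growth0 _ _ _
        (fun k => - (B^T *m (1%:M + A *m resolvent A k) *m (A *m w)))).
      apply: boundedN; apply: boundedM; last exact: bounded_const.
      apply: boundedM; first exact: bounded_const.
      apply: boundedD; first exact: bounded_const.
      by apply: boundedM; [exact: bounded_const|exact: bounded_resolvent].
    by move=> k; rewrite (e k) -resolventZ // scalerN scalemxAl scalemxAr.
  by split=> // k; apply/eqP; rewrite -oppr_eq0 -(e k) w0.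
move=> w g hw.
have g0 : g = 0.
  apply: (@bounded_growth0 _ _ _
      (fun k => B^T *m (1%:M + A *m resolvent A k) *m w)).
    apply: boundedM; last exact: bounded_const.
    apply: boundedM; first exact: bounded_const.
    apply: boundedD; first exact: bounded_const.
    by apply: boundedM; [exact: bounded_const|exact: bounded_resolvent].
  by move=> k; rewrite -resolventZ // -(hw k) scalemxAl scalemxAr.
split=> // j; rewrite {}g0 in hw.
elim: j w hw => [|j IH] w /main [h0 h1]; first by rewrite expr0 mulmx1.
by rewrite exprSr -mulmxE -!mulmxA; have := IH _ h1; rewrite -!mulmxA.
Qed.

Lemma controllable_inj n m (A : 'M[R]_n) (B : 'M[R]_(n, m)) (w : 'cV_n) :
  A^T = - A -> controllable A B -> (forall j, B^T *m ((- A) ^+ j) *m w = 0) -> w = 0.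
Proof.
move=> hA hc hw; apply: trmx_inj; rewrite trmx0.
have fr : row_free (\mxrow_(j < n) (A ^+ j *m B)) by rewrite /row_free; apply/eqP.
apply/eqP; rewrite -(mulmx_free_eq0 _ fr) mul_mxrow; apply/eqP.
rewrite -[RHS]mxrow0; apply/eq_mxrow=> j.
apply: trmx_inj; rewrite trmx0 !trmx_mul trmxK -(hw j); congr (_ *m _ *m _).
elim: (nat_of_ord j) => [|i IH]; first by rewrite !expr0 trmx1.
by rewrite exprS exprSr -!mulmxE trmx_mul IH hA.
Qed.

(** The transpose of [observe B A k] is (z - A)^-1 B at the k-th node, the response
    of the state: with the row convention a state is a combination of rows of
    these matrices. *)
Definition observe n m (B : 'M[R]_(n, m)) (A : 'M[R]_n) (k : nat) : 'M_(m, n) :=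
  B^T *m resolvent (- A) k.

Lemma observe_inj n m (B : 'M[R]_(n, m)) (A : 'M[R]_n) (w : 'cV_n) (g : 'cV_m) :
  A^T = - A -> controllable A B -> (forall k, observe B A k *m w = g) -> w = 0 /\ g = 0.
Proof.
move=> hA hc hw; have hA' : (- A)^T = - - A by rewrite raddfN /= hA.
have [g0 h] := observability hA' hw.
by split=> //; exact: controllable_inj hA hc h.
Qed.

(** Partial sums of row spaces stabilize at one of maximal rank, which contains
    every row space and is therefore full, its column kernel being trivial. *)
Lemma spanning m d (T : nat -> 'M[R]_(m, d)) :
  (forall w : 'cV_d, (forall k, T k *m w = 0) -> w = 0) ->
  exists N0, forall N, (N0 <= N)%N -> forall r (Y : 'M_(r, d)),
    exists c : nat -> 'M_(r, m), Y = \sum_(i < N) c i *m T i.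
Proof.
move=> hT; pose S N := (\sum_(i < N) <<T i>>)%MS.
have TS i N : (i < N)%N -> (T i <= S N)%MS.
  by move=> hi; apply: (submx_trans _ (sumsmx_sup (Ordinal hi) _ _)); rewrite ?genmxE.
have monoS N1 N2 : (N1 <= N2)%N -> (S N1 <= S N2)%MS.
  move=> h; apply/sumsmx_subP => i _; rewrite genmxE.
  by apply: TS; apply: leq_trans h.
pose P k := `[< exists N, \rank (S N) = k >].
have exP : exists k, P k by exists (\rank (S 0)); apply/asboolP; exists 0%N.
have boundP k : P k -> (k <= d)%N by move=> /asboolP [N <-]; exact: rank_leq_col.
have [_ /asboolP [N0 <-] maxN0] := ex_maxnP exP boundP.
exists N0 => N hN r Y.
(* Adding [T i] to the sum of maximal rank cannot increase its rank. *)
have TS0 i : (T i <= S N0)%MS.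
  have h : (S N0 <= S (maxn N0 i.+1))%MS by apply: monoS; exact: leq_maxl.
  have /andP[_ h'] : (S N0 == S (maxn N0 i.+1))%MS.
    rewrite -(geq_leqif (mxrank_leqif_eq h)); apply: maxN0; apply/asboolP.
    by exists (maxn N0 i.+1).
  by apply: submx_trans h'; apply: TS; exact: leq_maxr.
have fullS : row_full (S N).
  rewrite -cokermx_eq0; apply/eqP/trmx_inj/row_matrixP=> i.
  rewrite trmx0 row0 -tr_col; apply: trmx_inj; rewrite trmxK trmx0; apply: hT => k.
  rewrite colE mulmxA; have := submx_trans (TS0 k) (monoS _ _ hN).
  by rewrite submxE => /eqP ->; rewrite mul0mx.
have /sub_sumsmxP [v ->] : (Y <= S N)%MS by exact: submx_full.
have hv (i : nat) : exists c : 'M_(r, m), forall hi : (i < N)%N,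
    v (Ordinal hi) *m <<T i>>%MS = c *m T i.
  have [hi|hi] := EM (i < N)%N; last by exists 0 => hi'.
  have /submxP [c hc] : (v (Ordinal hi) *m <<T i>>%MS <= T i)%MS.
    by apply: submx_trans (submxMl _ _) _; rewrite genmxE.
  by exists c => hi'; rewrite -hc (bool_irrelevance hi' hi).
have [c hc] := choice hv; exists c; apply: eq_bigr => -[i hi] _ /=; exact: hc.
Qed.

End Asymptotics.

(** * States reached by superposed exponential signals *)

(** For identities that only use the additive structure of matrices: every
    product becomes a variable and the entries are compared in the field. *)
Ltac mx_linear :=
  repeat match goal with
  | |- context [@mulmx ?K ?p ?q ?r ?X ?Y] =>
      let t := fresh "t" in set t := (@mulmx K p q r X Y); clearbody t
  end; apply/matrixP => ? ?; rewrite !mxE; ring.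

Section StateMaps.
Variable R : realType.

Section OneSystem.
Variables (n m : nat) (M D : 'M[R]_m) (B : 'M[R]_(n, m)) (A : 'M[R]_n).
Hypotheses (hM : M^T = M) (hA : A^T = - A) (hD : D^T = - D).
Variable N : nat.
Local Notation F k := (transfer M D B A (node R k)).
Local Notation x := (observe B A).

(** State, input and output of a superposition of exponential signals: the signal
    with growth rate [node i] has amplitude [c i], one row per trajectory. *)
Definition state r (c : nat -> 'M[R]_(r, m)) : 'M_(r, n) := \sum_(i < N) c i *m observe B A i.
Definition input r (c : nat -> 'M[R]_(r, m)) : 'M_(r, m) := \sum_(i < N) c i.
Definition output r (c : nat -> 'M[R]_(r, m)) : 'M_(r, m) :=
  \sum_(i < N) c i *m (transfer M D B A (node R i))^T.
(** Differentiation of the superposed signals. *)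
Definition shift r (c : nat -> 'M[R]_(r, m)) : nat -> 'M_(r, m) := fun i => node R i *: c i.

Lemma state_mul r s (L : 'M_(s, r)) c : state (fun i => L *m c i) = L *m state c.
Proof. by rewrite /state mulmx_sumr; apply: eq_bigr => i _; rewrite mulmxA. Qed.

Lemma input_mul r s (L : 'M_(s, r)) c : input (fun i => L *m c i) = L *m input c.
Proof. by rewrite /input mulmx_sumr. Qed.

Lemma output_mul r s (L : 'M_(s, r)) c : output (fun i => L *m c i) = L *m output c.
Proof. by rewrite /output mulmx_sumr; apply: eq_bigr => i _; rewrite mulmxA. Qed.

Let hA' : (- A)^T = - - A. Proof. by rewrite raddfN /= hA. Qed.

Lemma tr_observe k : (x k)^T = resolvent A k *m B.
Proof.
rewrite /observe trmx_mul trmxK /resolvent trmx_inv; congr (invmx _ *m _).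
by rewrite raddfB /= tr_scalar_mx hA' opprK.
Qed.

Lemma transferE k : F k = node R k *: M + D + B^T *m resolvent A k *m B.
Proof. by []. Qed.

Lemma tr_transferE k : (F k)^T = node R k *: M - D + x k *m B.
Proof.
rewrite /transfer !raddfD /= linearZ /= hM hD; congr (_ + _).
by rewrite !trmx_mul trmxK trmx_inv raddfB /= tr_scalar_mx hA mulmxA.
Qed.

(** The resolvent identity for (z_i + A)^-1 and (z_j - A)^-1, whose inverses add up
    to z_i + z_j. *)
Lemma observe_gram i j :
  F j + (F i)^T = (node R i + node R j) *: (M + x i *m (x j)^T).
Proof.
rewrite transferE tr_transferE tr_observe scalerDr scalerDl.
have -> : (node R i + node R j) *: (x i *m (resolvent A j *m B)) =
    B^T *m resolvent A j *m B + x i *m B.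
  have -> : (node R i + node R j) *: (x i *m (resolvent A j *m B)) =
      B^T *m (resolvent (- A) i *m ((node R i + node R j)%:M) *m resolvent A j) *m B.
    by rewrite mul_mx_scalar -!(scalemxAl, scalemxAr) /observe !mulmxA.
  have -> : (node R i + node R j)%:M = ((node R i)%:M - - A) + ((node R j)%:M - A).
    by rewrite opprK addrACA subrr addr0 raddfD.
  rewrite mulmxDr mulmxDl resolventVl // mul1mx -(mulmxA (resolvent _ i)).
  by rewrite resolventV // mulmx1 mulmxDr mulmxDl.
mx_linear.
Qed.

Lemma tr_state r (c : nat -> 'M_(r, m)) :
  (state c)^T = \sum_(i < N) (x i)^T *m (c i)^T.
Proof. by rewrite /state raddf_sum; apply: eq_bigr => i _; exact: trmx_mul. Qed.

Lemma tr_input r (c : nat -> 'M_(r, m)) : (input c)^T = \sum_(i < N) (c i)^T.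
Proof. by rewrite /input raddf_sum. Qed.

(** The right-hand side involves the system only through its transfer function. *)
Lemma gram_sum r s (c : nat -> 'M_(r, m)) (e : nat -> 'M_(s, m)) :
  state c *m (state e)^T + input c *m M *m (input e)^T =
  \sum_(i < N) \sum_(j < N) (node R i + node R j)^-1 *:
     (c i *m (F j + (F i)^T) *m (e j)^T).
Proof.
rewrite tr_state tr_input /state /input !mulmx_suml -big_split /=; apply: eq_bigr => i _.
rewrite !mulmx_sumr -big_split /=; apply: eq_bigr => j _.
rewrite observe_gram -scalemxAr -scalemxAl scalerA mulVf ?scale1r; last first.
  by rewrite gt_eqF // addr_gt0 // node_gt0.
by rewrite mulmxDr mulmxDl addrC !mulmxA.
Qed.

(** The state equation A x = x' - B u, paired with x, and the output equation for
    B^T x. *)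
Lemma state_form r (c : nat -> 'M_(r, m)) :
  state c *m A *m (state c)^T = state c *m (state (shift c))^T
    - output c *m (input c)^T + input (shift c) *m M *m (input c)^T
    - input c *m D *m (input c)^T.
Proof.
have e1 : A *m (state c)^T = (state (shift c))^T - B *m (input c)^T.
  rewrite !tr_state tr_input !mulmx_sumr -sumrB; apply: eq_bigr => i _.
  rewrite /shift linearZ /= tr_observe -scalemxAr !scalemxAl.
  rewrite resolventZ // mulmxDl mul1mx mulmxDl -!mulmxA.
  by rewrite addrAC subrr add0r.
have e2 : state c *m B = output c - input (shift c) *m M + input c *m D.
  rewrite /state /input /shift /output !mulmx_suml -sumrB -big_split /=.
  apply: eq_bigr => i _; rewrite tr_transferE !mulmxDr mulmxN -scalemxAr -scalemxAl mulmxA.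
  mx_linear.
rewrite -mulmxA e1 mulmxBr mulmxA e2 mulmxDl mulmxBl.
mx_linear.
Qed.

End OneSystem.

Section Cascade.
Variables (n n' m : nat) (M D : 'M[R]_m) (B : 'M[R]_(n, m)) (A : 'M[R]_n).
Variables (M' D' : 'M[R]_m) (B' : 'M[R]_(n', m)) (A' : 'M[R]_n').
Hypotheses (hM : M^T = M) (hA : A^T = - A) (hD : D^T = - D).
Hypotheses (hM' : M'^T = M') (hA' : A'^T = - A') (hD' : D'^T = - D').
Hypothesis hinv : forall k,
  transfer M' D' B' A' (node R k) *m transfer M D B A (node R k) = 1%:M.
Variable N : nat.

(** The output signals of the first system, used as input signals of the second. *)
Definition feed r (c : nat -> 'M[R]_(r, m)) : nat -> 'M_(r, m) :=
  fun i => c i *m (transfer M D B A (node R i))^T.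

Lemma input_feed r (c : nat -> 'M_(r, m)) : input N (feed c) = output M D B A N c.
Proof. by []. Qed.

Lemma output_feed r (c : nat -> 'M_(r, m)) :
  output M' D' B' A' N (feed c) = input N c.
Proof.
by apply: eq_bigr => i _; rewrite /feed -mulmxA -trmx_mul hinv trmx1 mulmx1.
Qed.

Lemma shift_feed r (c : nat -> 'M_(r, m)) : shift (feed c) = feed (shift c).
Proof. by apply: funext => i; rewrite /shift /feed scalemxAl. Qed.

Lemma gram_feed r s (c : nat -> 'M_(r, m)) (e : nat -> 'M_(s, m)) :
  state B A N c *m (state B A N e)^T + input N c *m M *m (input N e)^T =
  state B' A' N (feed c) *m (state B' A' N (feed e))^T
    + output M D B A N c *m M' *m (output M D B A N e)^T.
Proof.
rewrite -!input_feed (gram_sum B hM hA hD) (gram_sum B' hM' hA' hD').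
apply: eq_bigr => i _; apply: eq_bigr => j _; congr (_ *: _).
rewrite /feed trmx_mul trmxK !mulmxA; congr (_ *m _).
move: (hinv i) (hinv j); rewrite -!(mulmxA (c i)).
move: (transfer M D B A (node R i)) (transfer M D B A (node R j)) => Fi Fj.
move: (transfer M' D' B' A' (node R i)) (transfer M' D' B' A' (node R j)) => Gi Gj hi hj.
congr (_ *m _); rewrite mulmxDr mulmxDl -mulmxA hj mulmx1 -trmx_mul hi trmx1 mul1mx.
by rewrite addrC.
Qed.

(** [state_form] for both systems: the terms with shifted states coincide by
    [gram_feed], and the remaining terms - y u^T - u D u^T and - u y^T - y D' y^T
    combine to - v D v^T by [inverse_asymptotics]. *)
Lemma form_feed r (c : nat -> 'M_(r, m)) :
  let u := input N c in let y := output M D B A N c in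
  let v := u + y *m D' in
  u *m M = 0 -> y *m M' = 0 ->
  [/\ v *m M = 0,
     state B A N c *m (state B A N c)^T
       = state B' A' N (feed c) *m (state B' A' N (feed c))^T
   & state B A N c *m A *m (state B A N c)^T
       = state B' A' N (feed c) *m A' *m (state B' A' N (feed c))^T
         - v *m D *m v^T].
Proof.
move=> u y v hu hy.
have [m0 md0 act] := inverse_asymptotics hA hA' hinv.
have yDM : y *m D' *m M = 0.
  apply/eqP; rewrite -oppr_eq0 -mulmxA -mulmxN.
  have -> : - (D' *m M) = M' *m D by apply/eqP; rewrite eq_sym -addr_eq0 md0.
  by rewrite mulmxA hy mul0mx.
have Mu : M *m u^T = 0 by apply: trmx_inj; rewrite trmx_mul trmxK hM hu trmx0.
have My : M' *m y^T = 0 by apply: trmx_inj; rewrite trmx_mul trmxK hM' hy trmx0.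
have MDy : M *m (D' *m y^T) = 0.
  apply: trmx_inj; rewrite !trmx_mul trmxK hM hD' mulmxN mulNmx.
  by rewrite yDM oppr0 trmx0.
split.
- by rewrite /v mulmxDl hu yDM addr0.
- have := gram_feed c c; rewrite -/u -/y hu hy !mul0mx !addr0; exact.
have gr : state B A N c *m (state B A N (shift c))^T
    = state B' A' N (feed c) *m (state B' A' N (shift (feed c)))^T.
  have := gram_feed c (shift c); rewrite -/u -/y hu hy !mul0mx !addr0 shift_feed; exact.
rewrite (state_form B hM hA hD) (state_form B' hM' hA' hD') output_feed !input_feed.
rewrite -/u -/y -gr -!mulmxA Mu My !mulmx0 !addr0.
have vT : v^T = u^T - D' *m y^T by rewrite /v raddfD /= trmx_mul hD' mulNmx.
have h1 := act _ _ y u^T hy Mu.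
have h2 : u *m D *m D' *m y^T = u *m y^T.
  by apply: trmx_inj; rewrite !trmx_mul trmxK hD hD' !mulNmx !mulmxN !opprK !mulmxA h1.
have h3 := act _ _ y (D' *m y^T) hy MDy.
rewrite !mulmxA in h3.
rewrite vT /v !mulmxDl !mulmxBr !mulmxA h1 h2 h3.
mx_linear.
Qed.

End Cascade.

End StateMaps.

(** * Common compressions from transfer functions *)

Section MainCompression.
Variable R : realType.

(** Every state is reached by a superposition with zero total input, because
    observing the state together with a constant is injective
    ([observe_inj]). *)
Lemma state_spanning n m (B : 'M[R]_(n, m)) (A : 'M[R]_n) :
  A^T = - A -> controllable A B ->
  exists N0, forall N, (N0 <= N)%N ->
    exists c : nat -> 'M_(n, m), state B A N c = 1%:M /\ input N c = 0.
Proof.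
move=> hA hc; pose T k := row_mx (observe B A k) (1%:M : 'M[R]_m).
have inj (w : 'cV_(n + m)) : (forall k, T k *m w = 0) -> w = 0.
  rewrite -[w]vsubmxK => hw.
  have e k : observe B A k *m usubmx w = - dsubmx w.
    have := hw k; rewrite mul_row_col mul1mx => /eqP.
    by rewrite addr_eq0 => /eqP.
  have [-> /eqP] := observe_inj hA hc e; rewrite oppr_eq0 => /eqP ->; exact: col_mx0.
have [N0 hN0] := spanning inj.
exists N0 => N /hN0 /(_ _ (row_mx 1%:M 0)) [c hc'].
exists c; apply: eq_row_mx; rewrite hc' /state /input /T.
transitivity (\sum_(i < N) row_mx (c i *m observe B A i) (c i)); last first.
  by apply: eq_bigr => i _; rewrite mul_mx_row mulmx1.
apply: (big_rec3 (fun a b s => row_mx a b = s)) => [|i a b s _ <-].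
  exact: row_mx0.
by rewrite add_row_mx.
Qed.

Lemma gram_rank r n n' (P : 'M[R]_(r, n)) (Q : 'M[R]_(r, n')) :
  P *m P^T = Q *m Q^T -> \rank P = \rank Q.
Proof.
have le a b (X : 'M[R]_(r, a)) (Y : 'M[R]_(r, b)) :
    X *m X^T = Y *m Y^T -> (\rank Y <= \rank X)%N.
  move=> h; have : (kermx X <= kermx Y)%MS.
    apply/rV_subP => x /sub_kermxP hx; apply/sub_kermxP; exact: gram_ker hx.
  move/mxrankS; rewrite !mxrank_ker.
  by have := rank_leq_row X; have := rank_leq_row Y; lia.
by move=> h; apply/eqP; rewrite eqn_leq !le.
Qed.

(** If P0 is onto, with right inverse given by L, then restricting it to the
    solutions of E costs at most the rank that E has on the image of L. *)
Lemma section_rank r n s (P0 : 'M[R]_(s, n)) (L : 'M[R]_(n, s)) (E : 'M[R]_(s, r)) :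
  L *m P0 = 1%:M -> (n - \rank (L *m E) <= \rank (kermx E *m P0))%N.
Proof.
move=> hL; have sub : (kermx (L *m E) *m L <= kermx E)%MS.
  by rewrite sub_kermx -mulmxA mulmx_ker.
have := mxrankS (submxMr P0 sub); rewrite -mulmxA hL mulmx1 mxrank_ker.
exact.
Qed.

(** The rows of M' lie in ker M and are orthogonal to it for the form D, so they
    contribute nothing to the rank of D on ker M. *)
Lemma skew_rank_on_kernel m (M M' D D' : 'M[R]_m) :
  M^T = M -> M' *m M = 0 -> M' *m D + D' *m M = 0 ->
  (\rank (kermx M *m D *m (kermx M)^T) + \rank M + \rank M' <= m)%N.
Proof.
move=> hM hM'M hMD; set Z := kermx M.
have hZ : (\rank Z = m - \rank M)%N by exact: mxrank_ker.
have sub : (M' <= Z :&: kermx (D *m Z^T))%MS.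
  rewrite sub_capmx !sub_kermx hM'M eqxx /= mulmxA.
  have -> : M' *m D = - (D' *m M) by apply/eqP; rewrite -addr_eq0 hMD.
  rewrite mulNmx -mulmxA; have -> : M *m Z^T = 0.
    by apply: trmx_inj; rewrite trmx_mul trmxK hM mulmx_ker trmx0.
  by rewrite mulmx0 oppr0.
have h1 := mxrankS sub.
have h2 : (\rank (Z *m (D *m Z^T)) + \rank (Z :&: kermx (D *m Z^T))%MS)%N = \rank Z.
  exact: mxrank_mul_ker.
rewrite -mulmxA; set t := \rank (Z *m (D *m Z^T)) in h2 *.
by have := rank_leq_row M; move: h1 h2 hZ; lia.
Qed.

(** The constraints u M = 0, y M' = 0 and the isotropy of v are imposed on
    superpositions that reach all states of both systems.  The states of the first
    system are already reached with u = 0, so there only the last two constraints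
    cost dimensions; those of the second are reached with y = 0, so there only the
    first and the last do. *)
Lemma inverse_common_compression n n' m (M D : 'M[R]_m) (B : 'M[R]_(n, m))
    (A : 'M[R]_n) (M' D' : 'M[R]_m) (B' : 'M[R]_(n', m)) (A' : 'M[R]_n') :
  M^T = M -> A^T = - A -> D^T = - D -> controllable A B ->
  M'^T = M' -> A'^T = - A' -> D'^T = - D' -> controllable A' B' ->
  (forall k, transfer M' D' B' A' (node R k) *m transfer M D B A (node R k) = 1%:M) ->
  exists2 r, (n + n' <= m + r.*2)%N & common_compression r A A'.
Proof.
move=> hM hA hD hc hM' hA' hD' hc' hinv.
have [N1 hN1] := state_spanning hA hc; have [N2 hN2] := state_spanning hA' hc'.
pose N := maxn N1 N2.
have [c1 [s1 i1]] := hN1 N (leq_maxl _ _).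
have [c2' [s2 i2]] := hN2 N (leq_maxr _ _).
(* Inputs of the first system whose outputs are the inputs [c2'] of the second. *)
pose c2 := feed M' D' B' A' c2'.
have fc2 : feed M D B A c2 = c2'.
  apply: funext => i; rewrite /feed /c2 /feed -mulmxA -trmx_mul.
  by rewrite (mulmx1C (hinv i)) trmx1 mulmx1.
pose c (i : nat) : 'M[R]_(n + n', m) := col_mx (c1 i) (c2 i).
pose L1 : 'M[R]_(n, n + n') := row_mx 1%:M 0.
pose L2 : 'M[R]_(n', n + n') := row_mx 0 1%:M.
have cL1 : (fun i => L1 *m c i) = c1.
  by apply: funext => i; rewrite mul_row_col mul1mx mul0mx addr0.
have cL2 : (fun i => L2 *m c i) = c2.
  by apply: funext => i; rewrite mul_row_col mul1mx mul0mx add0r.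
pose P0 := state B A N c; pose Q0 := state B' A' N (feed M D B A c).
pose u := input N c; pose y := output M D B A N c; pose v := u + y *m D'.
have feed_mul r (H : 'M_(r, n + n')) :
    feed M D B A (fun i => H *m c i) = fun i => H *m feed M D B A c i.
  by apply: funext => i; rewrite /feed mulmxA.
have LP : L1 *m P0 = 1%:M by rewrite /P0 -state_mul cL1.
have Lu : L1 *m u = 0 by rewrite /u -input_mul cL1.
have LQ : L2 *m Q0 = 1%:M by rewrite /Q0 -state_mul -feed_mul cL2 fc2.
have Ly : L2 *m y = 0.
  by rewrite /y -output_mul cL2 -input_feed fc2.
pose Z := kermx M.
have [G rG iso] := isotropic_kernel (skew_congr Z hD).
(* [pinvmx Z] gives the coordinates of v in terms of the rows spanning ker M,
   where the isotropic subspace was taken. *)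
pose E := row_mx (u *m M) (row_mx (y *m M') (v *m pinvmx Z *m G)).
have [m0 md0 _] := inverse_asymptotics hA hA' hinv.
have rS := skew_rank_on_kernel hM m0 md0.
have forms r (H : 'M_(r, n + n')) : H *m E = 0 ->
    (H *m P0) *m (H *m P0)^T = (H *m Q0) *m (H *m Q0)^T /\
    (H *m P0) *m A *m (H *m P0)^T = (H *m Q0) *m A' *m (H *m Q0)^T.
  rewrite !mul_mx_row -[0 in X in _ = X]row_mx0 => /eq_row_mx [hu].
  rewrite -[0 in X in _ = X]row_mx0 => /eq_row_mx [hy hv].
  rewrite mulmxA in hu; rewrite mulmxA in hy.
  have := form_feed hM hA hD hM' hA' hD' hinv (N := N) (c := fun i => H *m c i).
  rewrite input_mul output_mul feed_mul !state_mul -/P0 -/Q0 -/u -/y /=.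
  move=> /(_ hu hy); have -> : H *m u + H *m y *m D' = H *m v by rewrite mulmxDr mulmxA.
  move=> [vM -> ->]; split=> //.
  have vZ : (H *m v <= Z)%MS by rewrite sub_kermx vM.
  have hvG : H *m v *m pinvmx Z *m G = 0 by rewrite -!mulmxA; move: hv; rewrite -!mulmxA.
  have := iso _ _ hvG; rewrite trmx_mul => e.
  have -> : H *m v *m D *m (H *m v)^T = 0.
    rewrite -{1}(mulmxKpV vZ) -[X in _ *m X^T](mulmxKpV vZ) trmx_mul.
    by move: e; rewrite !trmx_mul !mulmxA.
  by rewrite subr0.
pose W := kermx E.
have WE : W *m E = 0 by exact: mulmx_ker.
have [gW _] := forms _ W WE.
pose r := \rank (W *m P0).
have rP : (n - (\rank M' + (\rank (kermx M *m D *m (kermx M)^T))./2) <= r)%N.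
  apply: leq_trans (section_rank E LP); apply: leq_sub2l.
  rewrite !mul_mx_row mulmxA Lu mul0mx.
  apply: leq_trans (mxrank_row_mx _ _) _; rewrite mxrank0 add0n.
  apply: leq_trans (mxrank_row_mx _ _) _; apply: leq_add.
    by rewrite mulmxA; exact: mxrankM_maxr.
  by apply: leq_trans rG; rewrite mulmxA; exact: mxrankM_maxr.
have rQ : (n' - (\rank M + (\rank (kermx M *m D *m (kermx M)^T))./2) <= r)%N.
  rewrite /r (gram_rank gW).
  apply: leq_trans (section_rank E LQ); apply: leq_sub2l.
  rewrite !mul_mx_row (mulmxA L2 y) Ly mul0mx.
  apply: leq_trans (mxrank_row_mx _ _) _; apply: leq_add.
    by rewrite mulmxA; exact: mxrankM_maxr.
  apply: leq_trans (mxrank_row_mx _ _) _; rewrite mxrank0 add0n.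
  by apply: leq_trans rG; rewrite mulmxA; exact: mxrankM_maxr.
exists r.
  by move: rP rQ rS; lia.
have /submxP [H hH] : (row_base (W *m P0) <= W *m P0)%MS by rewrite eq_row_base.
have HE : H *m W *m E = 0 by rewrite -mulmxA WE mulmx0.
have [g f] := forms _ _ HE.
have fP : row_free (H *m W *m P0) by rewrite -mulmxA -hH row_base_free.
exists (H *m W *m P0), (H *m W *m Q0); split=> //.
exact: gram_row_free g fP.
Qed.

(** Superpositions with zero total input reach every state of the first system, and
    the states they reach in the second have the same Gram matrix and the same
    form; T sends the unit vectors of the first
    state space to the corresponding states of the second. *)
Lemma same_transfer_conjugate n n' m (M D : 'M[R]_m) (B : 'M[R]_(n, m))
    (A : 'M[R]_n) (M' D' : 'M[R]_m) (B' : 'M[R]_(n', m)) (A' : 'M[R]_n') :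
  M^T = M -> A^T = - A -> D^T = - D -> controllable A B ->
  M'^T = M' -> A'^T = - A' -> D'^T = - D' ->
  (forall k, transfer M D B A (node R k) = transfer M' D' B' A' (node R k)) ->
  exists T : 'M_(n, n'), T *m T^T = 1%:M /\ A = T *m A' *m T^T.
Proof.
move=> hM hA hD hc hM' hA' hD' eqF.
have [N hN] := state_spanning hA hc; have [c [s0 i0]] := hN N (leqnn N).
have gr r (e : nat -> 'M_(r, m)) :
    state B A N c *m (state B A N e)^T = state B' A' N c *m (state B' A' N e)^T.
  have : state B A N c *m (state B A N e)^T + input N c *m M *m (input N e)^T
       = state B' A' N c *m (state B' A' N e)^T + input N c *m M' *m (input N e)^T.
    rewrite (gram_sum B hM hA hD) (gram_sum B' hM' hA' hD').
    by apply: eq_bigr => i _; apply: eq_bigr => j _; rewrite !eqF.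
  by rewrite i0 !mul0mx !addr0.
exists (state B' A' N c); split; first by rewrite -gr s0 trmx1 mulmx1.
rewrite (state_form B' hM' hA' hD') i0 trmx0 !mul0mx !mulmx0 !subr0 addr0 -gr.
have e : A = state B A N c *m A *m (state B A N c)^T.
  by rewrite s0 trmx1 mulmx1 mul1mx.
by rewrite [LHS]e (state_form B hM hA hD) i0 trmx0 !mul0mx !mulmx0 !subr0 addr0.
Qed.

End MainCompression.

(** * Eigenvalues in a spectral gap, poles and zeros *)

Section Gaps.
Variable R : realType.
Local Notation C := R[i].

Lemma diagonalizesN n (A : 'M[R]_n) (U : 'M[C]_n) (d : 'I_n -> R) :
  diagonalizes U d A -> diagonalizes U (fun i => - d i) (- A).
Proof.
case=> hU hA; split; first exact: hU.
have -> : imx (- A) = - imx A by rewrite /imx /cmx map_mxN scalerN.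
have -> : diag_mx (\row_i (- d i)%:C%C) = - diag_mx (\row_i (d i)%:C%C) :> 'M[C]_n.
  by apply/matrixP=> i j; rewrite !mxE rmorphN mulNrn.
by rewrite hA mulmxN mulNmx.
Qed.

Lemma common_compressionN n n' r (A : 'M[R]_n) (A' : 'M[R]_n') :
  common_compression r A A' -> common_compression r (- A) (- A').
Proof.
by move=> [P [Q [? ? ? e]]]; exists P, Q; rewrite !mulmxN !mulNmx e.
Qed.

(** [spectral_comparison] at the lower end of the gap, and at the upper end for the
    negated matrices; the eigenvalues of iA counted in the two inequalities are
    complementary because the gap contains none. *)
Lemma gap_count n n' r (A : 'M[R]_n) (A' : 'M[R]_n') U d U' d' (a b : R) :
  diagonalizes U d A -> diagonalizes U' d' A' -> common_compression r A A' ->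
  a < b -> (forall i, ~~ (a < d i < b)) ->
  (#|[pred i | (a < d' i < b)%R]| + r.*2 <= n + n')%N.
Proof.
move=> hU hU' hr hab hgap.
have [P [Q [_ fQ hN hF]]] := hr.
have [P2 [Q2 [_ fQ2 hN2 hF2]]] := common_compressionN hr.
have h1 := spectral_comparison a hU' hU fQ (esym hN) (esym hF).
have h2 := spectral_comparison (- b) (diagonalizesN hU') (diagonalizesN hU) fQ2
  (esym hN2) (esym hF2).
have e1 : (#|[pred i | (a < d i)%R]| + #|[pred i | (- b < - d i)%R]| = n)%N.
  have e := cardC [pred i | (a < d i)%R]; rewrite card_ord in e.
  rewrite -[RHS]e; congr (_ + _)%N; apply: eq_card => i; rewrite !inE ltrN2 -leNgt.
  have := hgap i; case: (ltP a (d i)) => /= h; first by move/negbTE.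
  by rewrite (le_lt_trans h hab).
have e2 : (#|[pred i | (a < d' i < b)%R]| + (#|[pred i | (d' i <= a)%R]|
    + #|[pred i | (- d' i <= - b)%R]|) = n')%N.
  have e := cardC [pred i | (a < d' i < b)%R]; rewrite card_ord in e.
  rewrite -[RHS]e; congr (_ + _)%N.
  rewrite -cardUI [X in (_ + X)%N]eq_card0 ?addn0.
    apply: eq_card => i; rewrite !inE lerN2 negb_and -leNgt -leNgt //.
  move=> i; rewrite !inE lerN2; apply/negP => /andP[h3 h4].
  by have := le_trans h4 h3; rewrite leNgt hab.
move: h1 h2 e1 e2.
move: #|[pred i | (a < d i)%R]| #|[pred i | (- b < - d i)%R]|
  #|[pred i | (a < d' i < b)%R]| #|[pred i | (d' i <= a)%R]|
  #|[pred i | (- d' i <= - b)%R]| => x1 x2 x3 x4 x5; lia.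
Qed.

Lemma realizationP n m F (M D : 'M[R]_m) (B : 'M[R]_(n, m)) (A : 'M[R]_n) :
  realization F M D B A ->
  [/\ M^T = M, A^T = - A, D^T = - D & controllable A B].
Proof.
by case=> -[hM _] hA hD hc _; split=> //; apply: (@cmx_inj R); rewrite -ctrmx_cmx.
Qed.

(** [same_transfer_conjugate] in both directions gives equal dimensions, and then
    equal ranks of A - z and A' - z. *)
Lemma eigenspace_rank_unique n n' m F (M D : 'M[R]_m) (B : 'M[R]_(n, m)) A
    (M' D' : 'M[R]_m) (B' : 'M[R]_(n', m)) A' (z : C) :
  realization F M D B A -> realization F M' D' B' A' ->
  \rank (eigenspace (cmx A) z) = \rank (eigenspace (cmx A') z).
Proof.
have half k k' (M1 D1 : 'M[R]_m) (B1 : 'M[R]_(k, m)) A1 (M2 D2 : 'M[R]_m)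
    (B2 : 'M[R]_(k', m)) A2 :
    realization F M1 D1 B1 A1 -> realization F M2 D2 B2 A2 ->
    (k <= k')%N /\ (k - \rank (eigenspace (cmx A1) z)
      <= k' - \rank (eigenspace (cmx A2) z))%N.
  move=> h1 h2; have [hM1 hA1 hD1 hc1] := realizationP h1.
  have [hM2 hA2 hD2 hc2] := realizationP h2.
  have [|T [TT eA]] := @same_transfer_conjugate R _ _ _ M1 D1 B1 A1 M2 D2 B2 A2
      hM1 hA1 hD1 hc1 hM2 hA2 hD2.
    by move=> i; apply: transfer_unique h1 h2 _; exact: node_gt0.
  split.
    have := mxrankM_maxr T T^T; rewrite TT mxrank1 mxrank_tr => h.
    exact: leq_trans h (rank_leq_col _).
  rewrite /eigenspace !mxrank_ker !subKn ?rank_leq_row //.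
  have -> : cmx A1 - z%:M = cmx T *m (cmx A2 - z%:M) *m cmx T^T.
    by rewrite mulmxBr mulmxBl -!cmxM -eA mul_mx_scalar -scalemxAl -cmxM TT
       /cmx map_mx1 scalemx1.
  exact: leq_trans (mxrankM_maxl _ _) (mxrankM_maxr _ _).
move=> h h'; have [l1 l2] := half _ _ _ _ _ _ _ _ _ _ h h'.
have [l3 l4] := half _ _ _ _ _ _ _ _ _ _ h' h.
have := rank_leq_row (eigenspace (cmx A) z).
by have := rank_leq_row (eigenspace (cmx A') z); lia.
Qed.

(** Stated for F and its inverse symmetrically, so that exchanging the two turns
    it into the statement on poles between zeros. *)
Lemma zeros_between n n' m F (M D : 'M[R]_m) (B : 'M[R]_(n, m)) A
    (M' D' : 'M[R]_m) (B' : 'M[R]_(n', m)) A' (w1 w2 : R) :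
  \det F != 0 -> realization F M D B A -> realization (invmx F) M' D' B' A' ->
  w1 < w2 -> (forall w, w1 < w < w2 -> ~ pole F (iR w)) ->
  mult_sum_le (zero_mult F) w1 w2 m.
Proof.
move=> hF h h' hw hgap s mu us hs.
have [hM hA hD hc] := realizationP h; have [hM' hA' hD' hc'] := realizationP h'.
have [r hr cr] := inverse_common_compression hM hA hD hc hM' hA' hD' hc'
  (fun k => transfer_inv hF h h' (node_gt0 R k)).
have [U [d hU]] := skew_diagonalizable hA.
have [U' [d' hU']] := skew_diagonalizable hA'.
have hgapd i : ~~ (- w2 < d i < - w1).
  apply/negP => hi; apply: (hgap (- d i)); first by rewrite ltrNr ltrNl andbC.
  exists (\rank (eigenspace (cmx A) (iR (- d i)))); last by exists n, M, D, B, A.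
  by rewrite (rank_eigenspace _ hU) opprK; apply/card_gt0P; exists i; rewrite !inE.
have hw' : - w2 < - w1 by rewrite ltrN2.
have cnt := gap_count hU hU' cr hw' hgapd.
suff le : (\sum_(w <- s) mu w <= #|[pred i | (- w2 < d' i < - w1)%R]|)%N.
  apply: leq_trans le _; rewrite -(leq_add2r r.*2).
  exact: leq_trans cnt hr.
have hmu w : w \in s -> mu w = #|[pred i | d' i == - w]|.
  move=> /hs [_ [k [M2 [D2 [B2 [A2 [h2 <-]]]]]]].
  by rewrite (eigenspace_rank_unique _ h2 h') (rank_eigenspace _ hU').
rewrite big_seq (eq_bigr _ hmu) -big_seq.
have -> : (\sum_(w <- s) #|[pred i | d' i == (- w)%R]|
    = \sum_(i < n') \sum_(w <- s) (d' i == (- w)%R))%N.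
  rewrite exchange_big /=; apply: eq_bigr => w _.
  by rewrite -sum1_card big_mkcond /=; apply: eq_bigr => i _; rewrite inE; case: eqP.
rewrite -sum1_card [in leqRHS]big_mkcond /=; apply: leq_sum => i _; rewrite inE.
(* Each eigenvalue is counted for at most one point of the duplicate-free [s]. *)
have cw : (\sum_(w <- s) (d' i == (- w)%R) = (- d' i \in s))%N.
  rewrite -(count_uniq_mem _ us) -sum1_count [RHS]big_mkcond /=.
  by apply: eq_bigr => w _; rewrite /= -eqr_oppLR eq_sym; case: (w == _).
rewrite cw; case: ifP => // /negP hi; first by case: (_ \in s).
case e : (- d' i \in s) => //; exfalso; apply: hi.
by have [+ _] := hs _ e; rewrite ltrNr ltrNl andbC.
Qed.

End Gaps.

(** * Interlacing of poles and zeros *)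

Theorem theorem6p4 (R : realType) (n m : nat) (F : 'M[ratfun R]_m)
  (M D : 'M[R]_m) (B : 'M[R]_(n, m)) (A : 'M[R]_n)
  (hPRO : PRO F) (hF : realization F M D B A) (hdet : \det F != 0)
  (m1 m2 m3 : nat)
  (V1 : 'M[R]_(m, m1)) (V2 : 'M[R]_(m, m2)) (V3 : 'M[R]_(m, m3))
  (hV1 : orthonormal_basis (X1 M) V1)
  (hV2 : orthonormal_basis (X2 M D) V2)
  (hV3 : orthonormal_basis (X3 M D) V3)
  (K1 : 'M[R]_m1) (hK1 : K1^T *m K1 = V1^T *m M *m V1)
  (Xi : 'M[R]_m3) (hXi : Xi^T *m Xi = 1%:M)
  (k : nat) (hk : k = (n + m1 - m3)%N) (Gamma : 'M[R]_(n + m1, k))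
  (hGamma : Gamma^T *m Gamma = 1%:M)
  (hGammaB : Gamma^T *m Btilde D B V1 V3 K1 Xi = 0) :
  let iA := imx A in
  let iAinv := imx (Ainv D B A V1 V2 K1 Gamma) in
  (* m2 is even: D22 is invertible and skew-symmetric *)
  let h := (m2./2)%:Z in
  (forall j : nat,
     [/\ (lambda iAinv (j%:Z - h - m3%:Z) <= lambda iA j%:Z)%E,
         (lambda iA j%:Z <= lambda iA (j%:Z + 1))%E
       & (lambda iA (j%:Z + 1) <= lambda iAinv (j%:Z + h + m1%:Z + 1))%E] /\
     [/\ (lambda iA (j%:Z - h - m1%:Z) <= lambda iAinv j%:Z)%E,
         (lambda iAinv j%:Z <= lambda iAinv (j%:Z + 1))%E
       & (lambda iAinv (j%:Z + 1) <= lambda iA (j%:Z + h + m3%:Z + 1))%E]) /\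
  (forall w1 w2 : R, 0 <= w1 -> subsequent (pole F) w1 w2 ->
     mult_sum_le (zero_mult F) w1 w2 m) /\
  (forall v1 v2 : R, 0 <= v1 -> subsequent (zero F) v1 v2 ->
     mult_sum_le (pole_mult F) v1 v2 m).
Proof.
move=> iA iAinv h.
have [_ hA hD _] := realizationP hF; split; [|split].
- have hAi : (Ainv D B A V1 V2 K1 Gamma)^T = - Ainv D B A V1 V2 K1 Gamma.
    exact: Ainv_skew.
  have [r hr cr] := Ainv_compression B A V1 V2 K1 hD hGamma.
  have cr' := common_compression_sym cr.
  have le1 i j : i + (m2./2)%:Z + m1%:Z <= j -> (lambda iA i <= lambda iAinv j)%E.
    by move=> hij; apply: lambda_le hA hAi cr _; move: hr hij; lia.
  have le2 i j : i + (m2./2)%:Z + m3%:Z <= j -> (lambda iAinv i <= lambda iA j)%E.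
    by move=> hij; apply: lambda_le hAi hA cr' _; move: hr hij hk; lia.
  have mono p (X : 'M[R]_p) (j : int) : X^T = - X ->
      (lambda (imx X) j <= lambda (imx X) (j + 1))%E.
    by move=> hX; apply: (lambda_le hX hX (common_compression_refl X)); lia.
  move=> j; split; split.
  + by apply: le2; rewrite /h; lia.
  + exact: mono.
  + by apply: le1; rewrite /h; lia.
  + by apply: le1; rewrite /h; lia.
  + exact: mono.
  + by apply: le2; rewrite /h; lia.
- move=> w1 w2 _ [hw _ _ hgap] [|w s] mu us hs; first by rewrite big_nil.
  have [_ [n' [M' [D' [B' [A' [h' _]]]]]]] := hs w (mem_head _ _).
  exact: (zeros_between hdet hF h' hw hgap) us hs.
- move=> v1 v2 _ [hv [k1 _ [n' [M' [D' [B' [A' [h' _]]]]]]] _ hgap].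
  (* The poles of F are the zeros of its inverse. *)
  have hFi : F \in unitmx by rewrite unitmxE unitfE.
  have hdet' : \det (invmx F) != 0 by rewrite det_inv invr_neq0.
  have hF' : realization (invmx (invmx F)) M D B A by rewrite invmxK.
  have := zeros_between hdet' h' hF' hv hgap.
  by rewrite /mult_sum_le /zero_mult invmxK.
Qed.
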